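(* Let $n$ and $p$ be integers with $2 \le p \le \frac{2}{5}n - 1$. Then the Stiefel manifold $V_{2p}\mathbb{R}^n = \mathrm{SO}(n)/\mathrm{SO}(n-2p)$ admits at least four (pairwise non-proportional) $\mathrm{SO}(n)$-invariant Einstein metrics which are determined by $\mathrm{Ad}(\mathrm{U}(p)\times \mathrm{SO}(n-2p))$-invariant scalar products on the tangent space $\mathfrak{m}$ at the identity coset. Two of these metrics are Jensen's metrics and the other two are different from Jensen's metrics.
   Context: $V_k\mathbb{R}^n \cong \mathrm{SO}(n)/\mathrm{SO}(n-k)$ is the manifold of orthonormal $k$-frames in $\mathbb{R}^n$. Put $G=\mathrm{SO}(n)$, with $H = \mathrm{SO}(n-2p)$ embedded in $G$ as the lower right diagonal block $\begin{pmatrix} 1_{2p} & 0\\ 0 & C\end{pmatrix}$, $C \in \mathrm{SO}(n-2p)$. Let $B(X,Y) = (n-2)\,\mathrm{tr}(XY)$ be the Killing form of $\mathfrak{so}(n)$, and let $\mathfrak{m}$ be the $(-B)$-orthogonal complement of $\mathfrak{so}(n-2p)$ in $\mathfrak{so}(n)$, identified with the tangent space of $G/H$ at $eH$. The $G$-invariant Riemannian metrics on $G/H$ correspond one-to-one to $\mathrm{Ad}(H)$-invariant scalar products on $\mathfrak{m}$. A Riemannian metric $g$ is Einstein if $\mathrm{Ric}_g = c\, g$ for some constant $c\in\mathbb{R}$. Metrics are counted up to scaling by positive constants. Let $\mathrm{U}(p) \subset \mathrm{SO}(2p)$ be the standard embedding (from $\mathbb{C}^p\cong\mathbb{R}^{2p}$),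 where $\mathrm{SO}(2p)$ is the upper left diagonal block of $\mathrm{SO}(n)$, so that $\mathrm{U}(p)\times\mathrm{SO}(n-2p)\subset \mathrm{SO}(n)$. There is an $\mathrm{Ad}(\mathrm{U}(p)\times\mathrm{SO}(n-2p))$-invariant, $(-B)$-orthogonal decomposition into mutually inequivalent irreducible submodules $$\mathfrak{m} = \mathfrak{m}_0\oplus\mathfrak{m}_1\oplus\mathfrak{m}_2\oplus\mathfrak{m}_3,$$ where $\mathfrak{m}_0$ is the ($1$-dimensional) center of $\mathfrak{u}(p)$, $\mathfrak{m}_1=\mathfrak{su}(p)$, $\mathfrak{m}_2$ is the $(-B)$-orthogonal complement of $\mathfrak{so}(2p)\oplus\mathfrak{so}(n-2p)$ in $\mathfrak{so}(n)$, and $\mathfrak{m}_3$ is the $(-B)$-orthogonal complement of $\mathfrak{u}(p)$ in $\mathfrak{so}(2p)$. The $\mathrm{Ad}(\mathrm{U}(p)\times\mathrm{SO}(n-2p))$-invariant scalar products on $\mathfrak{m}$ are $$\langle\cdot,\cdot\rangle = u_0(-B)|_{\mathfrak{m}_0}+u_1(-B)|_{\mathfrak{m}_1}+u_2(-B)|_{\mathfrak{m}_2}+u_3(-B)|_{\mathfrak{m}_3},\qquad u_0,u_1,u_2,u_3>0.$$ Jensen's metrics on $V_{2p}\mathbb{R}^n$ are the $\mathrm{SO}(n)$-invariant Einstein metrics determined by $\mathrm{Ad}(\mathrm{SO}(2p)\times\mathrm{SO}(n-2p))$-invariant scalar products of the form $x(-B)|_{\mathfrak{so}(2p)} + y(-B)|_{\mathfrak{m}_2}$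 with $x,y>0$, i.e. those Einstein metrics determined by scalar products $u_0(-B)|_{\mathfrak{m}_0}+u_1(-B)|_{\mathfrak{m}_1}+u_2(-B)|_{\mathfrak{m}_2}+u_3(-B)|_{\mathfrak{m}_3}$, $u_0,u_1,u_2,u_3>0$, with $u_0=u_1=u_3$. *)

(* Defs.v *)
From HB Require Import structures.
From mathcomp Require Import all_boot all_order all_algebra.
From mathcomp Require Import reals.
From mathcomp Require Import complex.

Set Implicit Arguments.
Unset Strict Implicit.
Unset Printing Implicit Defensive.

Import Order.TTheory GRing.Theory Num.Theory.
Local Open Scope ring_scope.

Definition lie (R : realType) (n : nat) (X Y : 'M[R]_n) : 'M[R]_n :=
  X *m Y - Y *m X.

Definition Ad (R : realType) (n : nat) (a X : 'M[R]_n) : 'M[R]_n :=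
  a *m X *m invmx a.

Definition SO (R : realType) (n : nat) (A : 'M[R]_n) : Prop :=
  A^T *m A = 1%:M /\ \det A = 1.

Definition so (R : realType) (n : nat) : {vspace 'M[R]_n} :=
  lker (linfun (@idfun 'M[R]_n \+ @trmx R n n)).

(* The Killing form B of so(n). The codomain is R^o so that linfun applies to
   the partial application killing Y. *)
Definition killing (R : realType) (n : nat) (Y X : 'M[R]_n) : R^o :=
  (n%:R - 2) * \tr (X *m Y).

Fact killing_is_linear (R : realType) (n : nat) (Y : 'M[R]_n) :
  linear (killing Y).
Proof.
move=> a X X'; rewrite /killing mulmxDl -scalemxAl mxtraceD mxtraceZ mulrDr.
by rewrite mulrCA.
Qed.
HB.instance Definition _ (R : realType) (n : nat) (Y : 'M[R]_n) :=
  GRing.isLinear.Build R 'M[R]_n R^o _ (killing Y) (killing_is_linear Y).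

Definition orthocompl (R : realType) (n : nat) (V W : {vspace 'M[R]_n}) :
    {vspace 'M[R]_n} :=
  (V :&: \bigcap_(i < \dim W) lker (linfun (killing (vbasis W)`_i)))%VS.

Lemma mem_so (R : realType) (n : nat) (X : 'M[R]_n) :
  (X \in so R n) = (X^T == - X).
Proof. by rewrite memv_ker lfunE /= addrC addr_eq0. Qed.

Lemma mem_orthocompl (R : realType) (n : nat) (V W : {vspace 'M[R]_n}) X :
  X \in orthocompl V W <->
  X \in V /\ (forall Y, Y \in W -> killing X Y = 0).
Proof.
have killingC (Z Y : 'M[R]_n) : killing Z Y = killing Y Z.
  by rewrite /killing mxtrace_mulC.
rewrite /orthocompl memv_cap; split=> [/andP[XV XW]|[XV XW]].
  split=> // Y /coord_vbasis ->; rewrite linear_sum big1 // => i _.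
  rewrite linearZ /= killingC.
  move: XW; rewrite memvE => /subv_bigcapP/(_ i isT).
  rewrite -memvE memv_ker lfunE /= => /eqP->.
  by rewrite scaler0.
apply/andP; split=> //; rewrite memvE; apply/subv_bigcapP => i _.
rewrite -memvE memv_ker lfunE /= killingC XW //.
by apply: vbasis_mem; rewrite mem_nth ?size_tuple.
Qed.

Definition trace_on (R : realType) (n : nat) (V : {vspace 'M[R]_n})
    (f : 'M[R]_n -> 'M[R]_n) : R :=
  \sum_(i < \dim V) coord (vbasis V) i (f (vbasis V)`_i).

(* The Stiefel manifold V_k R^(k + q) is G/H with G = SO(k + q) and H = SO(q)
   embedded as the lower right diagonal block. *)

Definition ulblock (R : realType) (k q : nat) (A : 'M[R]_k) : 'M[R]_(k + q) :=
  block_mx A 0 0 0.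
Definition drblock (R : realType) (k q : nat) (C : 'M[R]_q) : 'M[R]_(k + q) :=
  block_mx 0 0 0 C.

Fact ulblock_is_linear (R : realType) (k q : nat) : linear (@ulblock R k q).
Proof.
by move=> a A A'; rewrite /ulblock scale_block_mx add_block_mx !scaler0 !addr0.
Qed.
HB.instance Definition _ (R : realType) (k q : nat) :=
  GRing.isLinear.Build R _ _ _ (@ulblock R k q) (@ulblock_is_linear R k q).

Fact drblock_is_linear (R : realType) (k q : nat) : linear (@drblock R k q).
Proof.
by move=> a A A'; rewrite /drblock scale_block_mx add_block_mx !scaler0 !addr0.
Qed.
HB.instance Definition _ (R : realType) (k q : nat) :=
  GRing.isLinear.Build R _ _ _ (@drblock R k q) (@drblock_is_linear R k q).

Definition so_ul (R : realType) (k q : nat) : {vspace 'M[R]_(k + q)} :=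
  (linfun (@ulblock R k q) @: so R k)%VS.
Definition so_dr (R : realType) (k q : nat) : {vspace 'M[R]_(k + q)} :=
  (linfun (@drblock R k q) @: so R q)%VS.

(* The tangent space at the identity coset. *)
Definition mm (R : realType) (k q : nat) : {vspace 'M[R]_(k + q)} :=
  orthocompl (so R (k + q)) (so_dr R k q).

Definition mm2 (R : realType) (k q : nat) : {vspace 'M[R]_(k + q)} :=
  orthocompl (so R (k + q)) (so_ul R k q + so_dr R k q).

(* The components of an element of so(k + q) = mm (+) so(q). *)
Definition pr_m (R : realType) (k q : nat) : 'End('M[R]_(k + q)) :=
  daddv_pi (mm R k q) (so_dr R k q).
Definition pr_h (R : realType) (k q : nat) : 'End('M[R]_(k + q)) :=
  daddv_pi (so_dr R k q) (mm R k q).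

(* Bilinear forms on mm and bilinear maps mm x mm -> mm are represented by
   functions on the ambient matrix space; only their values on mm matter. *)
Definition bform (R : realType) (k q : nat) : Type :=
  'M[R]_(k + q) -> 'M[R]_(k + q) -> R.

Definition scalar_product (R : realType) (k q : nat) (g : bform R k q) : Prop :=
  [/\ {in mm R k q &, forall X Y, g X Y = g Y X},
      {in mm R k q & &, forall X Y Z, forall a : R,
        g (a *: X + Y) Z = a * g X Z + g Y Z}
    & {in mm R k q, forall X, X != 0 -> 0 < g X X}].

(* Invariance under Ad(K x SO(q)), for K a subgroup of SO(k). *)
Definition Ad_invariant (R : realType) (k q : nat) (K : 'M[R]_k -> Prop)
    (g : bform R k q) : Prop :=
  forall (A : 'M[R]_k) (C : 'M[R]_q), K A -> SO C ->
  {in mm R k q &, forall X Y,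
    g (Ad (block_mx A 0 0 C) X) (Ad (block_mx A 0 0 C) Y) = g X Y}.

(* An SO(k + q)-invariant Riemannian metric, given by its value at eH. *)
Definition invariant_metric (R : realType) (k q : nat) (g : bform R k q) :
    Prop :=
  scalar_product g /\ Ad_invariant (fun A => A = 1%:M) g.

(* By Nomizu's theorem the invariant affine connections on the reductive space
   G/H correspond to the Ad(H)-equivariant bilinear maps L : mm x mm -> mm.
   The torsion and the curvature at eH are then
     T(X,Y)  = L(X)Y - L(Y)X - [X,Y]_m,
     R(X,Y)Z = L(X)L(Y)Z - L(Y)L(X)Z - L([X,Y]_m)Z - [[X,Y]_h,Z]. *)
Definition connection_map (R : realType) (k q : nat) : Type :=
  'M[R]_(k + q) -> 'M[R]_(k + q) -> 'M[R]_(k + q).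

Definition invariant_connection (R : realType) (k q : nat)
    (L : connection_map R k q) : Prop :=
  [/\ {in mm R k q &, forall X Y, L X Y \in mm R k q},
      {in mm R k q & &, forall X Y Z, forall a : R,
        L (a *: X + Y) Z = a *: L X Z + L Y Z},
      {in mm R k q & &, forall X Y Z, forall a : R,
        L Z (a *: X + Y) = a *: L Z X + L Z Y}
    & forall C : 'M[R]_q, SO C -> {in mm R k q &, forall X Y,
        Ad (block_mx 1%:M 0 0 C) (L X Y) =
        L (Ad (block_mx 1%:M 0 0 C) X) (Ad (block_mx 1%:M 0 0 C) Y)}].

Definition torsion_free (R : realType) (k q : nat) (L : connection_map R k q) :
    Prop :=
  {in mm R k q &, forall X Y, L X Y - L Y X = pr_m R k q (lie X Y)}.

Definition metric_connection (R : realType) (k q : nat) (g : bform R k q)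
    (L : connection_map R k q) : Prop :=
  {in mm R k q & &, forall X Y Z, g (L X Y) Z + g Y (L X Z) = 0}.

Definition levi_civita (R : realType) (k q : nat) (g : bform R k q)
    (L : connection_map R k q) : Prop :=
  [/\ invariant_connection L, torsion_free L & metric_connection g L].

Definition curvature (R : realType) (k q : nat) (L : connection_map R k q)
    (X Y Z : 'M[R]_(k + q)) : 'M[R]_(k + q) :=
  L X (L Y Z) - L Y (L X Z) - L (pr_m R k q (lie X Y)) Z
  - lie (pr_h R k q (lie X Y)) Z.

Definition Ric (R : realType) (k q : nat) (L : connection_map R k q)
    (Y Z : 'M[R]_(k + q)) : R :=
  trace_on (mm R k q) (fun X => curvature L X Y Z).

(* The Levi-Civita connection is unique, hence the existential quantifier. *)
Definition einstein (R : realType) (k q : nat) (g : bform R k q) : Prop :=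
  invariant_metric g /\
  exists (L : connection_map R k q) (c : R),
    levi_civita g L /\ {in mm R k q &, forall X Y, Ric L X Y = c * g X Y}.

Definition proportional (R : realType) (k q : nat) (g g' : bform R k q) :
    Prop :=
  exists2 c : R, 0 < c & {in mm R k q &, forall X Y, g X Y = c * g' X Y}.

(* The Einstein metrics given by x (-B)|so(k) + y (-B)|mm2. *)
Definition jensen (R : realType) (k q : nat) (g : bform R k q) : Prop :=
  [/\ einstein g, Ad_invariant (@SO R k) g
    & exists x y : R, [/\ 0 < x, 0 < y &
        forall A A' Z Z', A \in so_ul R k q -> A' \in so_ul R k q ->
          Z \in mm2 R k q -> Z' \in mm2 R k q ->
          g (A + Z) (A' + Z') = x * - killing A A' + y * - killing Z Z']].

(* Multiplication by M on C^p, in the real coordinates x + iy |-> (x, y). *)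
Definition realify (R : realType) (p : nat) (M : 'M[R[i]]_p) : 'M[R]_(p + p) :=
  block_mx (map_mx (@complex.Re R) M) (- map_mx (@complex.Im R) M)
           (map_mx (@complex.Im R) M) (map_mx (@complex.Re R) M).

Definition unitary_group (R : realType) (p : nat) (A : 'M[R]_(p + p)) : Prop :=
  exists2 M : 'M[R[i]]_p, M \is unitarymx & A = realify M.

(* Main.v *)
Require Import Defs.
From HB Require Import structures.
From mathcomp Require Import all_boot all_order all_algebra.
From mathcomp Require Import reals.
From mathcomp Require Import complex.
From mathcomp Require Import polyrcf ring lra zify.
Import Order.TTheory GRing.Theory Num.Theory.
Local Open Scope ring_scope.
Set Implicit Arguments.
Unset Strict Implicit.
Unset Printing Implicit Defensive.

(** Put k = 2p and q = n - 2p. A tangent vector is a pair (a, b) with a in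
    so(k) and b a k x q matrix, and up to scaling the metrics in question are
    given by three numbers u0, u1, u3, the scale on m2 being 1.

    The Levi-Civita connection is explicit: on X in m_i and Y in m_j, its
    component in m_l is (u_l + u_j - u_i) / (2 u_l) times that of [X, Y]. If
    N_Y denotes the operator X |-> L(X)Y, then torsion freeness, cyclicity of
    the trace and the vanishing of the trace of N_Y reduce the Ricci tensor to
    - tr(N_Y N_Z) plus a term from the isotropy algebra ([Ric_trace]). These
    traces are computed on spaces of matrices, where X |-> A X B and
    X |-> A X^T B have traces tr A tr B and tr(A^T B) ([strace_mul],
    [strace_mul_tr], [trace_on_mm]); the result is [Ric_conn] with
    [strace_so_conn_so_conn]. The Einstein condition becomes a system of four
    rational equations in u0, u1, u3 and the Einstein constant
    ([einstein_system], [metric_einstein]).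

    If u0 = u1 = u3 = x the system reduces to
    (n - 1) x^2 - 2 (n - 2) x + 2 (p - 1) = 0, which has two positive roots:
    these are Jensen's metrics ([jensen_roots], [jensen_metric]).

    For the others put u3 = z, u1 = r z, u0 = v z and s = q z^2. Once the
    factor r - 1 is divided out, the equation of m3 is linear in r, so the
    solutions with r != 1 lie on a rational curve parametrized by s, and one
    equation in z remains ([residual_solution]). Its left side is positive for
    small and for large z, and negative at s = p, which is where the
    hypothesis p <= 2n/5 - 1 enters ([residual_mid]); so it has two roots
    ([other_solutions]). On the curve r = 1 happens for s > 0 only if p = 2
    and s = p, which is not a root ([ratio1_neq1]). Hence u1 != u3 at both
    roots, and these metrics are not Jensen's; as all four have scale 1 on m2,
    they are proportional only if their scales agree
    ([proportional_metrics]). *)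

(** * Traces of linear operators on matrices *)

Lemma addmxE (R : realType) m n (A B : 'M[R]_(m, n)) i j :
  (A + B) i j = A i j + B i j.
Proof. by rewrite mxE. Qed.
Lemma oppmxE (R : realType) m n (A : 'M[R]_(m, n)) i j : (- A) i j = - A i j.
Proof. by rewrite mxE. Qed.
Lemma scalemxE (R : realType) m n c (A : 'M[R]_(m, n)) i j :
  (c *: A) i j = c * A i j.
Proof. by rewrite mxE. Qed.
Lemma zeromxE (R : realType) m n i j : (0 : 'M[R]_(m, n)) i j = 0.
Proof. by rewrite mxE. Qed.

(** Products are expanded over sums and scalars; an identity between linear
    combinations of products is then checked entrywise, each product being an
    atom. *)
Ltac mxexpand :=
  rewrite ?(mulmxDl, mulmxDr, mulNmx, mulmxN, scalerDr, scalerN, mulmxA,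
     mul0mx, mulmx0, =^~ scalemxAl, =^~ scalemxAr, opprD, opprK, scalerA).
Ltac mxlin := apply/matrixP => ? ?; rewrite ?(addmxE, oppmxE, scalemxE,
  zeromxE).

Section TrmxLinear.
Variables (R : realType) (m n : nat).
Implicit Types A B : 'M[R]_(m, n).
Lemma trmxD A B : (A + B)^T = A^T + B^T. Proof. exact: linearD. Qed.
Lemma trmxN A : (- A)^T = - A^T. Proof. exact: linearN. Qed.
Lemma trmxZ c A : (c *: A)^T = c *: A^T. Proof. exact: linearZ. Qed.
End TrmxLinear.

Section Trace.
Variable R : realType.

Definition strace m n (F : 'M[R]_(m, n) -> 'M[R]_(m, n)) : R :=
  \sum_i \sum_j F (delta_mx i j) i j.

Lemma eq_strace m n (F G : 'M[R]_(m, n) -> 'M[R]_(m, n)) :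
  F =1 G -> strace F = strace G.
Proof.
by move=> h; apply: eq_bigr => i _; apply: eq_bigr => j _; rewrite h.
Qed.

Lemma straceD m n (F G : 'M[R]_(m, n) -> 'M[R]_(m, n)) :
  strace (fun X => F X + G X) = strace F + strace G.
Proof.
rewrite -big_split; apply: eq_bigr => i _; rewrite -big_split.
by apply: eq_bigr => j _; rewrite mxE.
Qed.

Lemma straceZ m n c (F : 'M[R]_(m, n) -> 'M[R]_(m, n)) :
  strace (fun X => c *: F X) = c * strace F.
Proof.
rewrite mulr_sumr; apply: eq_bigr => i _; rewrite mulr_sumr.
by apply: eq_bigr => j _; rewrite mxE.
Qed.

Lemma straceN m n (F : 'M[R]_(m, n) -> 'M[R]_(m, n)) :
  strace (fun X => - F X) = - strace F.
Proof.
by rewrite -[RHS]mulN1r -straceZ; apply: eq_strace => X; rewrite scaleN1r.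
Qed.

Lemma mul_delta_mulE m n m' n' (A : 'M[R]_(m', m)) (B : 'M[R]_(n, n')) i j i'
  j' :
  (A *m delta_mx i j *m B) i' j' = A i' i * B j j'.
Proof.
rewrite mxE (bigD1 j) //= big1 => [|l nl].
  rewrite addr0 mxE (bigD1 i) //= big1 => [|l nl]; rewrite !mxE !eqxx ?mulr1
    ?addr0 //.
  by rewrite (negPf nl) mulr0.
by rewrite mxE big1 ?mul0r // => t _; rewrite mxE (negPf nl) andbF mulr0.
Qed.

Lemma strace_mul m n (A : 'M[R]_m) (B : 'M[R]_n) :
  strace (fun X => A *m X *m B) = \tr A * \tr B.
Proof.
rewrite /mxtrace big_distrl; apply: eq_bigr => i _ /=; rewrite mulr_sumr.
by apply: eq_bigr => j _; rewrite mul_delta_mulE.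
Qed.

Lemma strace_mull m n (A : 'M[R]_m) :
  strace (fun X : 'M[R]_(m, n) => A *m X) = n%:R * \tr A.
Proof.
rewrite mulrC -(mxtrace1 R n) -strace_mul.
by apply: eq_strace => X; rewrite mulmx1.
Qed.

Lemma strace_mulr m n (B : 'M[R]_n) :
  strace (fun X : 'M[R]_(m, n) => X *m B) = m%:R * \tr B.
Proof.
rewrite -(mxtrace1 R m) -strace_mul.
by apply: eq_strace => X; rewrite mul1mx.
Qed.

(** Together with [strace_mul] this is the source of all the numbers in the
    Ricci tensor: every operator met below is a combination of X |-> A X B, X
    |-> A X^T B and operators of rank one. *)
Lemma strace_mul_tr m n (A B : 'M[R]_(m, n)) :
  strace (fun X => A *m X^T *m B) = \tr (A^T *m B).
Proof.
rewrite /strace /mxtrace exchange_big; apply: eq_bigr => j _ /=.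
rewrite mxE; apply: eq_bigr => i _.
by rewrite trmx_delta mul_delta_mulE !mxE.
Qed.

Lemma matrix_linear_sum m n (V : lmodType R) (F : 'M[R]_(m, n) -> V) X :
  linear F -> F X = \sum_i \sum_j X i j *: F (delta_mx i j).
Proof.
move=> hF; pose H := HB.pack F (GRing.isLinear.Build _ _ _ _ F hF) : {linear _
  -> _}.
rewrite -[F]/(H : _ -> _) {1}[X]matrix_sum_delta linear_sum; apply: eq_bigr =>
  i _.
by rewrite linear_sum; apply: eq_bigr => j _; rewrite linearZ.
Qed.

Lemma strace_rank1 m n (phi : 'M[R]_(m, n) -> R^o) (A : 'M[R]_(m, n)) :
  linear phi -> strace (fun X => phi X *: A) = phi A.
Proof.
move=> h; rewrite (matrix_linear_sum A h); apply: eq_bigr => i _.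
by apply: eq_bigr => j _; rewrite mxE mulrC.
Qed.

(** Cyclicity, for operators between two different matrix spaces: it trades a
    trace over so(k) for a trace over the k x q matrices. *)
Lemma straceC m n m' n' (F : 'M[R]_(m, n) -> 'M[R]_(m', n'))
  (G : 'M[R]_(m', n') -> 'M[R]_(m, n)) : linear F -> linear G ->
  strace (fun X => F (G X)) = strace (fun X => G (F X)).
Proof.
move=> hF hG; rewrite /strace.
transitivity (\sum_i \sum_j \sum_i' \sum_j'
   G (delta_mx i j) i' j' * F (delta_mx i' j') i j).
  apply: eq_bigr => i _; apply: eq_bigr => j _.
  rewrite (matrix_linear_sum _ hF) summxE; apply: eq_bigr => i' _.
  by rewrite summxE; apply: eq_bigr => j' _; rewrite mxE.
transitivity (\sum_i' \sum_j' \sum_i \sum_j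
   G (delta_mx i j) i' j' * F (delta_mx i' j') i j); last first.
  apply: eq_bigr => i _; apply: eq_bigr => j _.
  rewrite (matrix_linear_sum (F _) hG) summxE; apply: eq_bigr => i' _.
  by rewrite summxE; apply: eq_bigr => j' _; rewrite mxE mulrC.
under eq_bigr => i _ do rewrite exchange_big.
rewrite exchange_big; apply: eq_bigr => i' _ /=.
under eq_bigr => i _ do rewrite exchange_big.
by rewrite exchange_big.
Qed.

Section TraceOn.
Variables (n : nat) (V : {vspace 'M[R]_n}).
Implicit Types f g : 'M[R]_n -> 'M[R]_n.

Lemma eq_trace_on f g : {in V, f =1 g} -> trace_on V f = trace_on V g.
Proof.
move=> h; apply: eq_bigr => i _; rewrite h //.
by apply: vbasis_mem; rewrite mem_nth ?size_tuple.
Qed.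

Lemma trace_onD f g :
  trace_on V (fun X => f X + g X) = trace_on V f + trace_on V g.
Proof. by rewrite -big_split; apply: eq_bigr => i _; rewrite linearD. Qed.

Lemma trace_onN f : trace_on V (fun X => - f X) = - trace_on V f.
Proof. by rewrite -sumrN; apply: eq_bigr => i _; rewrite linearN. Qed.

(** A trace may be read on any family v whose dual functionals xi resolve the
    identity of V, whether or not v is free. For so(k) this makes the
    redundant family of all the (E_ij - E_ji) / 2 usable, so that no sum is
    ever restricted to i < j. *)
Lemma trace_on_frame (I : finType) (v : I -> 'M[R]_n) (xi : I -> 'M[R]_n -> R)
  f :
  linear f -> {in V, forall X, f X \in V} -> (forall s, v s \in V) ->
  (forall s, linear (xi s : _ -> R^o)) ->
  {in V, forall X, X = \sum_s xi s X *: v s} ->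
  trace_on V f = \sum_s xi s (f (v s)).
Proof.
move=> hf fV vV lxi hX.
pose H := HB.pack f (GRing.isLinear.Build _ _ _ _ f hf) : {linear _ -> _}.
pose K s := HB.pack (xi s : _ -> R^o)
   (GRing.isLinear.Build _ _ _ _ _ (lxi s)) : {linear _ -> _}.
have eV i : (vbasis V)`_(i : 'I_(\dim V)) \in V.
  by apply: vbasis_mem; rewrite mem_nth ?size_tuple.
transitivity (\sum_(i < \dim V) \sum_s
    coord (vbasis V) i (f (v s)) * xi s (vbasis V)`_i).
  apply: eq_bigr => i _; rewrite {1}(hX _ (eV i)) -[f]/(H : _ -> _) linear_sum.
  rewrite linear_sum; apply: eq_bigr => s _.
  by rewrite !linearZ mulrC.
rewrite exchange_big; apply: eq_bigr => s _ /=.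
(* Expanding f (v s) in the chosen basis identifies the sums over s. *)
rewrite [in RHS](coord_vbasis (fV _ (vV s))) -[xi s]/(K s : _ -> _) linear_sum.
by apply: eq_bigr => i _; rewrite linearZ.
Qed.

Lemma trace_onC f g : linear f -> linear g -> {in V, forall X, f X \in V} ->
  {in V, forall X, g X \in V} ->
  trace_on V (fun X => f (g X)) = trace_on V (fun X => g (f X)).
Proof.
move=> hf hg fV gV.
pose F := HB.pack f (GRing.isLinear.Build _ _ _ _ f hf) : {linear _ -> _}.
pose G := HB.pack g (GRing.isLinear.Build _ _ _ _ g hg) : {linear _ -> _}.
have eV i : (vbasis V)`_(i : 'I_(\dim V)) \in V.
  by apply: vbasis_mem; rewrite mem_nth ?size_tuple.
rewrite /trace_on.
transitivity (\sum_(i < \dim V) \sum_(j < \dim V)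
    coord (vbasis V) i (f (vbasis V)`_j) * coord (vbasis V) j (g (vbasis
      V)`_i)).
  apply: eq_bigr => i _.
  rewrite {1}(coord_vbasis (gV _ (eV i))) -[f]/(F : _ -> _) linear_sum
    linear_sum.
  by apply: eq_bigr => j _; rewrite !linearZ mulrC.
rewrite exchange_big; apply: eq_bigr => j _ /=.
rewrite [in RHS](coord_vbasis (fV _ (eV j))) -[g]/(G : _ -> _) linear_sum
  linear_sum.
by apply: eq_bigr => i _; rewrite !linearZ.
Qed.

End TraceOn.
End Trace.

(** * The tangent space in block coordinates *)

Section Tangent.
Variable R : realType.

Lemma mxtrace_tr_mul m n (A : 'M[R]_(m, n)) :
  \tr (A^T *m A) = \sum_j \sum_i A i j ^+ 2.
Proof.
by apply: eq_bigr => j _; rewrite mxE; apply: eq_bigr => i _; rewrite mxE.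
Qed.

Lemma mxtrace_tr_mul_ge0 m n (A : 'M[R]_(m, n)) : 0 <= \tr (A^T *m A).
Proof.
rewrite mxtrace_tr_mul; apply: sumr_ge0 => j _; apply: sumr_ge0 => i _.
exact: sqr_ge0.
Qed.

Lemma mxtrace_tr_mul_eq0 m n (A : 'M[R]_(m, n)) : \tr (A^T *m A) = 0 -> A = 0.
Proof.
rewrite mxtrace_tr_mul => /psumr_eq0P h; apply/matrixP => i j.
have /psumr_eq0P/(_ i isT) : \sum_i0 A i0 j ^+ 2 = 0.
  by apply: h => // j' _; apply: sumr_ge0 => i' _; apply: sqr_ge0.
rewrite mxE => h0; apply/eqP; rewrite -sqrf_eq0; apply/eqP/h0 => i' _.
exact: sqr_ge0.
Qed.

Definition skew k (a : 'M[R]_k) : 'M[R]_k := 2^-1 *: (a - a^T).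

Lemma skewT k (a : 'M[R]_k) : (skew a)^T = - skew a.
Proof. by rewrite /skew linearZ linearB /= trmxK -scalerN opprB. Qed.

Lemma skew_id k (a : 'M[R]_k) : a^T = - a -> skew a = a.
Proof.
by move=> h; rewrite /skew h opprK -mulr2n -scaler_nat scalerA mulVf ?scale1r
  ?pnatr_eq0.
Qed.

Lemma skew_linear k : linear (@skew k).
Proof. by move=> c a b; rewrite /skew linearP; mxlin; rewrite !mxE; ring. Qed.

Variables k q : nat.
Hypothesis hkq : (2 < k + q)%N.

(** An element of the tangent space is determined by its blocks a (skew) and
    b; a is its component in so(k) and b its component in m2. *)
Definition emb (a : 'M[R]_k) (b : 'M[R]_(k, q)) : 'M[R]_(k + q) :=
  block_mx a b (- b^T) 0.

Lemma emb_linear c a b a' b' :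
  emb (c *: a + a') (c *: b + b') = c *: emb a b + emb a' b'.
Proof.
rewrite /emb scale_block_mx add_block_mx linearP scaler0 addr0.
by congr block_mx; mxlin; ring.
Qed.

Lemma dim_gt2 : 0 < (k + q)%:R - 2 :> R.
Proof. by rewrite subr_gt0 ltr_nat. Qed.

Lemma killing_block (a a' : 'M[R]_k) b b' d d' c c' :
  killing (block_mx a b d c) (block_mx a' b' d' c' : 'M[R]_(k + q)) =
  ((k + q)%:R - 2) * (\tr (a' *m a) + \tr (b' *m d) + (\tr (d' *m b) + \tr (c'
    *m c))).
Proof. by rewrite /killing mulmx_block mxtrace_block !mxtraceD. Qed.

Lemma mem_so_block (a : 'M[R]_k) b d c :
  (block_mx a b d c \in so R (k + q)) = [&& a^T == - a, d == - b^T & c^T == -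
    c].
Proof.
rewrite mem_so tr_block_mx opp_block_mx; apply/eqP/and3P.
  by move/eq_block_mx => [-> _ -> ->]; rewrite opprK !eqxx.
by case=> /eqP-> /eqP-> /eqP->; rewrite opprK linearN /= trmxK.
Qed.

Lemma so_drP X : reflect (exists2 c : 'M[R]_q, c^T = - c & X = drblock k c)
  (X \in so_dr R k q).
Proof.
apply: (iffP memv_imgP) => -[c h1 h2]; exists c => //.
- by apply/eqP; rewrite -mem_so.
- by rewrite h2 lfunE.
- by rewrite mem_so h1.
- by rewrite h2 lfunE.
Qed.

Lemma so_ulP X : reflect (exists2 a : 'M[R]_k, a^T = - a & X = ulblock q a)
  (X \in so_ul R k q).
Proof.
apply: (iffP memv_imgP) => -[c h1 h2]; exists c => //.
- by apply/eqP; rewrite -mem_so.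
- by rewrite h2 lfunE.
- by rewrite mem_so h1.
- by rewrite h2 lfunE.
Qed.

Lemma emb_mm a b : a^T = - a -> emb a b \in mm R k q.
Proof.
move=> ha; apply/mem_orthocompl; split.
  by rewrite mem_so_block ha linear0 oppr0 !eqxx.
move=> Y /so_drP[c hc ->].
by rewrite killing_block !(mulmx0, mul0mx) !mxtrace0 !addr0 mulr0.
Qed.

(** The trace form is definite on so(q), so orthogonality to so(q) kills the
    lower right block. *)
Lemma mmP X : X \in mm R k q -> exists a b, a^T = - a /\ X = emb a b.
Proof.
move=> /mem_orthocompl; rewrite -(submxK X) mem_so_block.
set a := ulsubmx X; set b := ursubmx X; set d := dlsubmx X; set c := drsubmx X.
move=> [/and3P[/eqP ha /eqP hd /eqP hc] hK].
exists a, b; split => //; rewrite /emb hd; congr block_mx.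
have : drblock k c \in so_dr R k q by apply/so_drP; exists c.
move/hK; rewrite killing_block !(mulmx0, mul0mx) !mxtrace0 !add0r.
move/eqP; rewrite mulf_eq0 gt_eqF ?dim_gt2 //= => /eqP h.
by apply: mxtrace_tr_mul_eq0; rewrite hc mulNmx linearN /= h oppr0.
Qed.

Lemma mm2P X : X \in mm2 R k q -> exists b, X = emb 0 b.
Proof.
move=> /mem_orthocompl [hso hK].
have : X \in mm R k q.
  apply/mem_orthocompl; split=> // Y hY; apply: hK.
  by rewrite -[Y]add0r memv_add ?mem0v.
case/mmP=> a [b [ha hX]]; exists b; rewrite hX; congr emb.
have : ulblock q a + 0 \in (so_ul R k q + so_dr R k q)%VS.
  by apply: memv_add; rewrite ?mem0v //; apply/so_ulP; exists a.
move/hK; rewrite addr0 hX killing_block !(mulmx0, mul0mx) !mxtrace0 !addr0.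
move/eqP; rewrite mulf_eq0 gt_eqF ?dim_gt2 //= => /eqP h.
by apply: mxtrace_tr_mul_eq0; rewrite ha mulNmx linearN /= h oppr0.
Qed.

Lemma emb_ul_ur X : X \in mm R k q -> X = emb (ulsubmx X) (ursubmx X).
Proof. by case/mmP=> a [b [_ ->]]; rewrite /emb block_mxKul block_mxKur. Qed.

Lemma ul_mm X : X \in mm R k q -> (ulsubmx X)^T = - ulsubmx X.
Proof. by case/mmP=> a [b [ha ->]]; rewrite /emb block_mxKul. Qed.

Lemma mm_dr0 : (mm R k q :&: so_dr R k q)%VS = 0%VS.
Proof.
apply/eqP; rewrite -subv0; apply/subvP => X; rewrite memv_cap memv0.
case/andP => /mmP[a [b [_ ->]]] /so_drP[c _ /eq_block_mx[-> -> _ _]].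
by rewrite /emb linear0 oppr0 -/(block_mx 0 0 0 0) block_mx0.
Qed.

Section Components.
Variables (a : 'M[R]_k) (b : 'M[R]_(k, q)) (c : 'M[R]_q).
Hypotheses (ha : a^T = - a) (hc : c^T = - c).

Lemma block_emb_dr : block_mx a b (- b^T) c = emb a b + drblock k c.
Proof. by rewrite /emb /drblock add_block_mx !addr0 add0r. Qed.

Lemma pr_m_block : pr_m R k q (block_mx a b (- b^T) c) = emb a b.
Proof.
have hd : drblock k c \in so_dr R k q by apply/so_drP; exists c.
rewrite block_emb_dr linearD /= /pr_m daddv_pi_id ?mm_dr0 ?emb_mm //.
suff -> : daddv_pi (mm R k q) (so_dr R k q) (drblock k c) = 0 by rewrite addr0.
have hid := daddv_pi_id (etrans (capvC _ _) mm_dr0) hd.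
have := daddv_pi_add mm_dr0 (subvP (addvSr _ _) _ hd).
by rewrite hid -[RHS]add0r => /addIr.
Qed.

Lemma pr_h_block : pr_h R k q (block_mx a b (- b^T) c) = drblock k c.
Proof.
have hd : drblock k c \in so_dr R k q by apply/so_drP; exists c.
have := daddv_pi_add mm_dr0 (w := block_mx a b (- b^T) c).
rewrite -/(pr_m R k q) -/(pr_h R k q) pr_m_block block_emb_dr.
rewrite memv_add ?emb_mm // => /(_ isT) /addrI; exact.
Qed.
End Components.

Lemma lie_emb (a a' : 'M[R]_k) (b b' : 'M[R]_(k, q)) :
  a^T = - a -> a'^T = - a' ->
  let e := lie (emb a b) (emb a' b') in
  [/\ e = block_mx (lie a a' + b' *m b^T - b *m b'^T) (a *m b' - a' *m b)
       (- (a *m b' - a' *m b)^T) (b'^T *m b - b^T *m b'),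
     (lie a a' + b' *m b^T - b *m b'^T)^T = - (lie a a' + b' *m b^T - b *m b'^T)
   & (b'^T *m b - b^T *m b')^T = - (b'^T *m b - b^T *m b')].
Proof.
move=> ha ha' /=; split.
- rewrite /lie /emb !mulmx_block opp_block_mx add_block_mx.
  rewrite !(mulmx0, mul0mx, addr0, subr0, add0r, mulmxN, mulNmx, opprK).
  rewrite trmxD trmxN !trmx_mul ha ha'; congr block_mx;
    by rewrite ?(mulmxN, mulNmx, opprK); mxlin; ring.
- rewrite /lie !(trmxD, trmxN) !trmx_mul !trmxK ha ha'.
  rewrite ?(mulmxN, mulNmx, opprK); mxlin; ring.
- by rewrite trmxD trmxN !trmx_mul !trmxK opprB.
Qed.

Lemma pr_m_lie (a a' : 'M[R]_k) (b b' : 'M[R]_(k, q)) :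
  a^T = - a -> a'^T = - a' ->
  pr_m R k q (lie (emb a b) (emb a' b')) =
  emb (lie a a' + b' *m b^T - b *m b'^T) (a *m b' - a' *m b).
Proof.
by move=> ha ha'; have [-> h1 h2] := lie_emb b b' ha ha'; rewrite pr_m_block.
Qed.

Lemma pr_h_lie (a a' : 'M[R]_k) (b b' : 'M[R]_(k, q)) :
  a^T = - a -> a'^T = - a' ->
  pr_h R k q (lie (emb a b) (emb a' b')) = drblock k (b'^T *m b - b^T *m b').
Proof.
by move=> ha ha'; have [-> h1 h2] := lie_emb b b' ha ha'; rewrite pr_h_block.
Qed.

Lemma lie_dr_emb (c : 'M[R]_q) a b : c^T = - c ->
  lie (drblock k c) (emb a b) = emb 0 (- (b *m c)).
Proof.
move=> hc; rewrite /lie /emb /drblock !mulmx_block opp_block_mx add_block_mx.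
rewrite !(mulmx0, mul0mx, addr0, subr0, add0r, mulmxN, mulNmx, opprK).
by rewrite trmxN trmx_mul hc mulNmx !opprK !oppr0.
Qed.

(** The frame consists of the (E_ij - E_ji) / 2 in so(k) and of the E_ij in
    m2; only the diagonal blocks of f with respect to so(k) + m2 contribute.
    *)
Lemma trace_on_mm f : linear f -> {in mm R k q, forall X, f X \in mm R k q} ->
  trace_on (mm R k q) f =
    strace (fun a => ulsubmx (f (emb (skew a) 0))) +
    strace (fun b => ursubmx (f (emb 0 b))).
Proof.
move=> hf fV.
(* The dual functionals are the entries of the two upper blocks. *)
pose v (s : ('I_k * 'I_k) + ('I_k * 'I_q)) := match s with
  | inl ij => emb (skew (delta_mx ij.1 ij.2)) 0
  | inr ij => emb 0 (delta_mx ij.1 ij.2) end.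
pose xi (s : ('I_k * 'I_k) + ('I_k * 'I_q)) (X : 'M[R]_(k + q)) := match s with
  | inl ij => ulsubmx X ij.1 ij.2
  | inr ij => ursubmx X ij.1 ij.2 end.
rewrite (trace_on_frame (v := v) (xi := xi)) //.
- rewrite big_sumType /= /strace; congr (_ + _); last by rewrite pair_bigA.
  by rewrite pair_bigA.
- by case=> -[i j] /=; rewrite emb_mm ?skewT // linear0 oppr0.
- by case=> -[i j] c X Y /=; rewrite !mxE.
move=> X hX; rewrite {1}(emb_ul_ur hX) big_sumType /=.
have E0 (I : finType) (F : I -> R) G :
    emb (\sum_s F s *: G s) 0 = \sum_s F s *: emb (G s) 0.
  apply: (big_rec2 (fun x y => emb x 0 = y)).
    by rewrite /emb linear0 oppr0 block_mx0.
  move=> i x y _ <-; rewrite -{1}[0]add0r -{1}(scaler0 _ (F i)).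
  exact: emb_linear.
have E1 (I : finType) (F : I -> R) G :
    emb 0 (\sum_s F s *: G s) = \sum_s F s *: emb 0 (G s).
  apply: (big_rec2 (fun x y => emb 0 x = y)).
    by rewrite /emb linear0 oppr0 block_mx0.
  move=> i x y _ <-; rewrite -{1}[0]add0r -{1}(scaler0 _ (F i)).
  exact: emb_linear.
rewrite -E0 -E1 -[LHS]/(emb (ulsubmx X) (ursubmx X)).
have <- : ulsubmx X = \sum_s ulsubmx X s.1 s.2 *: skew (delta_mx s.1 s.2).
  rewrite -{1}(skew_id (ul_mm hX)) (matrix_linear_sum _ (@skew_linear k)).
  by rewrite pair_bigA.
have <- : ursubmx X = \sum_s ursubmx X s.1 s.2 *: delta_mx s.1 s.2.
  by rewrite {1}[ursubmx X]matrix_sum_delta pair_bigA.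
by rewrite -[emb _ 0]scale1r -emb_linear !scale1r addr0 add0r.
Qed.

End Tangent.

(** * The metrics and their Levi-Civita connections *)

Section LieTrace.
Variables (R : realType) (k : nat).
Implicit Types x y z : 'M[R]_k.

Lemma mxtraceN x : \tr (- x) = - \tr x. Proof. exact: linearN. Qed.

Lemma lie_linearl y : linear ((@lie R k)^~ y).
Proof. by move=> c x x'; rewrite /lie; mxexpand; mxlin; ring. Qed.
Lemma lie_linearr x : linear (@lie R k x).
Proof. by move=> c y y'; rewrite /lie; mxexpand; mxlin; ring. Qed.
Lemma lieC x y : lie x y = - lie y x.
Proof. by rewrite /lie opprB. Qed.
Lemma lieDl x x' y : lie (x + x') y = lie x y + lie x' y.
Proof. by rewrite -[x]scale1r lie_linearl !scale1r. Qed.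
Lemma lieDr x y y' : lie x (y + y') = lie x y + lie x y'.
Proof. by rewrite -[y]scale1r lie_linearr !scale1r. Qed.
Lemma lieZl c x y : lie (c *: x) y = c *: lie x y.
Proof. by rewrite /lie; mxexpand; mxlin; ring. Qed.
Lemma lieZr c x y : lie x (c *: y) = c *: lie x y.
Proof. by rewrite /lie; mxexpand; mxlin; ring. Qed.
Lemma lieNl x y : lie (- x) y = - lie x y.
Proof. by rewrite /lie; mxexpand; mxlin; ring. Qed.
Lemma lieNr x y : lie x (- y) = - lie x y.
Proof. by rewrite /lie; mxexpand; mxlin; ring. Qed.
Lemma lie_skew x y : x^T = - x -> y^T = - y -> (lie x y)^T = - lie x y.
Proof.
move=> hx hy; rewrite /lie trmxD trmxN !trmx_mul hx hy.
by rewrite !(mulmxN, mulNmx, opprK) opprB.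
Qed.
Lemma tr_lieA x y z : \tr (lie x y *m z) = \tr (x *m lie y z).
Proof.
rewrite /lie mulmxBl mulmxBr !mxtraceD !mxtraceN !mulmxA; congr (_ - _).
by rewrite -(mulmxA y) (mxtrace_mulC y).
Qed.
Lemma tr_lieC x y z : \tr (lie x y *m z) = - \tr (lie x z *m y).
Proof. by rewrite !tr_lieA (lieC z) mulmxN mxtraceN opprK. Qed.
End LieTrace.
Ltac trexpand := rewrite ?(mxtraceD, mxtraceN, mxtraceZ, mxtrace0).
Ltac lieexpand := rewrite ?(lieDl, lieDr, lieZl, lieZr, lieNl, lieNr).

(** For a complex structure J, a skew a splits as [jlin] + [janti], its
    components in u(p) and in m3: the parts that commute and anticommute with
    J. *)
HB.lock Definition jlin (R : realType) k (J a : 'M[R]_k) : 'M[R]_k :=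
  2^-1 *: (a - J *m a *m J).

HB.lock Definition janti (R : realType) k (J a : 'M[R]_k) : 'M[R]_k :=
  2^-1 *: (a + J *m a *m J).

(** The component in the centre m0 = R J of u(p); that in su(p) = m1 is [jlin]
    minus [jcenter]. *)
HB.lock Definition jcenter (R : realType) k (J a : 'M[R]_k) : 'M[R]_k :=
  (- (\tr (a *m J) / k%:R)) *: J.

(** The operator u0 on m0, u1 on m1, and 0 on m3. *)
HB.lock Definition uscale (R : realType) k (J : 'M[R]_k) (u0 u1 : R) a :
  'M[R]_k :=
  u1 *: jlin J a + (u0 - u1) *: jcenter J a.

(** The metric operator on so(k): the scalar product is -B(soscale a, a'). *)
HB.lock Definition soscale (R : realType) k (J : 'M[R]_k) (u0 u1 u3 : R) a :
  'M[R]_k :=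
  uscale J u0 u1 a + u3 *: janti J a.

(** The operator 1 - soscale / (2 u3) on u(p), extended by 0 to m3. For X in
    m_i and Y in m_j the component in m_l of the covariant derivative of Y
    along X is (u_l + u_j - u_i) / (2 u_l) times that of [X, Y]; with X in
    u(p) and Y in m3 this coefficient is 1 - u_i / (2 u3). *)
HB.lock Definition udrift (R : realType) k (J : 'M[R]_k) (u0 u1 u3 : R) a :
  'M[R]_k :=
  jlin J a - (2 * u3)^-1 *: uscale J u0 u1 a.

(** The Levi-Civita connection of SO(k) for [soscale], by the same
    coefficients, in the cases (u(p), u(p)), (m3, u(p)), (u(p), m3) and (m3,
    m3). They are 1/2 in the first case, since the metric is bi-invariant on
    U(p), and in the last, since source and direction have the same scale. *)
HB.lock Definition so_conn (R : realType) k (J : 'M[R]_k) (u0 u1 u3 : R) a z :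
  'M[R]_k :=
  2^-1 *: lie (jlin J a) (jlin J z)
  + (2 * u3)^-1 *: lie (janti J a) (uscale J u0 u1 z)
  + lie (udrift J u0 u1 u3 a) (janti J z) + 2^-1 *: lie (janti J a) (janti J z).

Section Conn.
Variables (R : realType) (k q : nat).
Variable J : 'M[R]_k.
Hypotheses (hJT : J^T = - J) (hJJ : J *m J = - 1%:M).
Variables u0 u1 u3 : R.

Lemma mulJJ m (x : 'M_(m, k)) : x *m J *m J = - x.
Proof. by rewrite -mulmxA hJJ mulmxN mulmx1. Qed.
Lemma mulJJl m (x : 'M_(k, m)) : J *m (J *m x) = - x.
Proof. by rewrite mulmxA hJJ mulNmx mul1mx. Qed.

Local Notation lin := (jlin J).
Local Notation anti := (janti J).
Local Notation cen := (jcenter J).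
Local Notation lamu := (uscale J u0 u1).
Local Notation drift := (udrift J u0 u1 u3).
Definition jlinE := jlin.unlock.
Definition jantiE := janti.unlock.
Definition jcenterE := jcenter.unlock.
Definition uscaleE := uscale.unlock.
Definition udriftE := udrift.unlock.

Lemma jlin_linear : linear lin.
Proof. by move=> c a b; rewrite jlinE; mxexpand; mxlin; ring. Qed.
Lemma janti_linear : linear anti.
Proof. by move=> c a b; rewrite jantiE; mxexpand; mxlin; ring. Qed.
Lemma jcenter_linear : linear cen.
Proof.
move=> c a b; rewrite jcenterE mulmxDl -scalemxAl; trexpand; mxlin; ring.
Qed.
Lemma jlin_janti a : lin a + anti a = a.
Proof. rewrite jlinE jantiE; mxlin; lra. Qed.

Lemma jlin_comm a : J *m lin a = lin a *m J.
Proof.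
rewrite jlinE -scalemxAl -scalemxAr; congr (_ *: _).
by rewrite mulmxBl mulmxBr mulJJ -!mulmxA mulJJl opprK addrC opprK.
Qed.
Lemma janti_anti a : J *m anti a = - (anti a *m J).
Proof.
rewrite jantiE -scalemxAl -scalemxAr -scalerN; congr (_ *: _).
by rewrite mulmxDl mulmxDr mulJJ -!mulmxA mulJJl opprD addrC opprK.
Qed.
Lemma comm_jlin x : J *m x = x *m J -> lin x = x.
Proof. by move=> h; rewrite jlinE h mulJJ; mxlin; lra. Qed.
Lemma comm_janti x : J *m x = x *m J -> anti x = 0.
Proof. by move=> h; rewrite jantiE h mulJJ subrr scaler0. Qed.
Lemma anti_jlin x : J *m x = - (x *m J) -> lin x = 0.
Proof. by move=> h; rewrite jlinE h mulNmx mulJJ opprK subrr scaler0. Qed.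
Lemma anti_janti x : J *m x = - (x *m J) -> anti x = x.
Proof. by move=> h; rewrite jantiE h mulNmx mulJJ; mxlin; lra. Qed.

Lemma anti_trJ x : J *m x = - (x *m J) -> \tr (x *m J) = 0.
Proof.
by move=> h; apply/eqP; rewrite -eqNr -mxtraceN -h mxtrace_mulC.
Qed.
Lemma anti_jcenter x : J *m x = - (x *m J) -> cen x = 0.
Proof.
by move/anti_trJ; rewrite jcenterE => ->; rewrite mul0r oppr0 scale0r.
Qed.

Lemma lie_cc x y : J *m x = x *m J -> J *m y = y *m J ->
  J *m lie x y = lie x y *m J.
Proof.
move=> hx hy; rewrite /lie mulmxBl mulmxBr !mulmxA hx hy.
by rewrite -!mulmxA hx hy.
Qed.
Lemma lie_ca x y : J *m x = x *m J -> J *m y = - (y *m J) ->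
  J *m lie x y = - (lie x y *m J).
Proof.
move=> hx hy; rewrite /lie mulmxBl mulmxBr !mulmxA hx hy mulNmx.
by rewrite -!mulmxA hx hy mulmxN opprD.
Qed.
Lemma lie_ac x y : J *m x = - (x *m J) -> J *m y = y *m J ->
  J *m lie x y = - (lie x y *m J).
Proof. by move=> hx hy; rewrite lieC mulmxN lie_ca // mulNmx. Qed.
Lemma lie_aa x y : J *m x = - (x *m J) -> J *m y = - (y *m J) ->
  J *m lie x y = lie x y *m J.
Proof.
move=> hx hy; rewrite /lie mulmxBl mulmxBr !mulmxA hx hy !mulNmx.
by rewrite -!mulmxA hx hy !mulmxN !opprK.
Qed.

Lemma lie_cc_trJ x y : J *m y = y *m J -> \tr (lie x y *m J) = 0.
Proof.
move=> hy; rewrite tr_lieA [lie y J](_ : _ = 0) ?mulmx0 ?mxtrace0 //.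
by rewrite /lie hy subrr.
Qed.

Lemma jlin_skew a : a^T = - a -> (lin a)^T = - lin a.
Proof.
move=> h; rewrite jlinE trmxZ trmxD trmxN !trmx_mul h hJT.
by rewrite -scalerN; congr (_ *: _); rewrite !(mulmxN, mulNmx, opprK) mulmxA
  opprD opprK.
Qed.
Lemma janti_skew a : a^T = - a -> (anti a)^T = - anti a.
Proof.
move=> h; rewrite jantiE trmxZ trmxD !trmx_mul h hJT.
by rewrite -scalerN; congr (_ *: _); rewrite !(mulmxN, mulNmx, opprK) mulmxA
  opprD.
Qed.
Lemma jcenter_skew a : (cen a)^T = - cen a.
Proof. by rewrite jcenterE trmxZ hJT scalerN. Qed.
Lemma jcenter_comm a : J *m cen a = cen a *m J.
Proof. by rewrite jcenterE -scalemxAr -scalemxAl. Qed.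
Lemma tr_jcenter x y :
  \tr (cen x *m y) = - (\tr (x *m J) * \tr (y *m J) / k%:R).
Proof. by rewrite jcenterE -scalemxAl mxtraceZ (mxtrace_mulC J); ring. Qed.
Lemma tr_lie_jcenter x y z : J *m y = y *m J -> \tr (lie x y *m cen z) = 0.
Proof.
by move=> hy; rewrite jcenterE -scalemxAr mxtraceZ lie_cc_trJ // mulr0.
Qed.
Lemma jlin0 :
  lin 0 = 0.
Proof. by rewrite jlinE mulmx0 mul0mx subrr scaler0. Qed.
Lemma janti0 :
  anti 0 = 0.
Proof. by rewrite jantiE mulmx0 mul0mx addr0 scaler0. Qed.

Local Notation lam := (soscale J u0 u1 u3).
Definition soscaleE := soscale.unlock.
Local Notation nab := (so_conn J u0 u1 u3).
Definition so_connE := so_conn.unlock.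

Lemma uscale_linear : linear lamu.
Proof.
by move=> c a b; rewrite uscaleE jlin_linear jcenter_linear; mxlin; ring.
Qed.
Lemma soscale_linear : linear lam.
Proof.
by move=> c a b; rewrite !soscaleE uscale_linear janti_linear; mxlin; ring.
Qed.
Lemma udrift_linear : linear drift.
Proof.
by move=> c a b; rewrite udriftE jlin_linear uscale_linear; mxlin; ring.
Qed.
Lemma so_conn_linearl z : linear (nab^~ z).
Proof.
move=> c a b; rewrite so_connE jlin_linear udrift_linear janti_linear.
move: (lin _) (lin _) (lin _) (drift _) (drift _) (anti _) (anti _) (anti _)
  (lamu _).
by move=> *; lieexpand; mxlin; ring.
Qed.
Lemma so_conn_linearr a : linear (nab a).
Proof.
move=> c y z; rewrite so_connE jlin_linear uscale_linear janti_linear.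
move: (lin _) (lin _) (lin _) (drift _) (anti _) (anti _) (anti _) (lamu _)
  (lamu _).
by move=> *; lieexpand; mxlin; ring.
Qed.

Lemma uscale_comm a : J *m lamu a = lamu a *m J.
Proof.
by rewrite uscaleE mulmxDr mulmxDl -!scalemxAr -!scalemxAl jlin_comm
  jcenter_comm.
Qed.
Lemma udrift_comm a : J *m drift a = drift a *m J.
Proof.
by rewrite udriftE mulmxBr mulmxBl -!scalemxAr -!scalemxAl jlin_comm
  uscale_comm.
Qed.

Lemma uscale_skew a : a^T = - a -> (lamu a)^T = - lamu a.
Proof.
by move=> h; rewrite uscaleE trmxD !trmxZ jcenter_skew jlin_skew // !scalerN
  opprD.
Qed.
Lemma soscale_skew a : a^T = - a -> (lam a)^T = - lam a.
Proof.
by move=> h; rewrite !soscaleE trmxD !trmxZ uscale_skew // janti_skew //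
  !scalerN opprD.
Qed.
Lemma udrift_skew a : a^T = - a -> (drift a)^T = - drift a.
Proof.
by move=> h; rewrite udriftE trmxD trmxN trmxZ uscale_skew // jlin_skew //
  scalerN opprD.
Qed.
Lemma so_conn_skew a z : a^T = - a -> z^T = - z -> (nab a z)^T = - nab a z.
Proof.
move=> ha hz; rewrite so_connE 3!trmxD !trmxZ.
by rewrite !lie_skew ?jlin_skew ?janti_skew ?uscale_skew ?udrift_skew //
  !scalerN !opprD.
Qed.

Lemma tr_jlin_janti x y : \tr (lin x *m anti y) = 0.
Proof.
have e : J *m (lin x *m anti y) *m J = lin x *m anti y.
  by rewrite mulmxA jlin_comm -mulmxA -mulmxA (mulmxA J) janti_anti mulNmx
    mulmxN mulJJ mulmxN opprK.
by apply/eqP; rewrite -eqNr -{2}e (mxtrace_mulC _ J) mulJJl mxtraceN.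
Qed.

Lemma tr_jlin x y : \tr (lin x *m y) = \tr (lin x *m lin y).
Proof. by rewrite -{1}(jlin_janti y) mulmxDr mxtraceD tr_jlin_janti addr0. Qed.
Lemma tr_janti x y : \tr (anti x *m y) = \tr (anti x *m anti y).
Proof.
by rewrite -{1}(jlin_janti y) mulmxDr mxtraceD mxtrace_mulC tr_jlin_janti add0r.
Qed.

Lemma tr_soscale_sym x y : \tr (lam x *m y) = \tr (lam y *m x).
Proof.
rewrite !soscaleE !uscaleE !mulmxDl -!scalemxAl !mxtraceD !mxtraceZ !tr_jcenter
  (tr_jlin x y) (tr_jlin y x) (tr_janti x y) (tr_janti y x).
by rewrite (mxtrace_mulC (lin x)) (mxtrace_mulC (anti x)); ring.
Qed.

Lemma tr_soscale x y :
  \tr (lam x *m y) = \tr (lin x *m lamu y) + u3 * \tr (anti x *m anti y).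
Proof.
rewrite !soscaleE mulmxDl -!scalemxAl mxtraceD mxtraceZ tr_janti; congr (_ + _).
rewrite uscaleE mulmxDl mulmxDr -!scalemxAl -!scalemxAr !mxtraceD !mxtraceZ
  tr_jcenter tr_jlin.
rewrite (mxtrace_mulC (lin x) (cen y)) tr_jcenter.
have -> : \tr (lin x *m J) = \tr (x *m J).
  by rewrite -{2}(jlin_janti x) mulmxDl mxtraceD (anti_trJ (janti_anti x))
    addr0.
by ring.
Qed.

Lemma tr_lie_uscale x y z :
  \tr (lie (lin x) (lin y) *m lamu z) = u1 * \tr (lie (lin x) (lin y) *m lin z).
Proof.
rewrite uscaleE mulmxDr -!scalemxAr mxtraceD !mxtraceZ tr_lie_jcenter ?mulr0
  ?addr0 //.
exact: jlin_comm.
Qed.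

Lemma jlin_so_conn a z :
  lin (nab a z) = 2^-1 *: (lie (lin a) (lin z) + lie (anti a) (anti z)).
Proof.
rewrite so_connE; set x := lie (lin a) _; set y := lie _ (lamu z); set w := lie
  (drift a) _.
set t := lie (anti a) (anti z).
rewrite -[w in LHS]scale1r -addrA -addrA.
have hx : lin x = x by apply/comm_jlin/lie_cc; exact: jlin_comm.
have ht : lin t = t by apply/comm_jlin/lie_aa; exact: janti_anti.
have hy : lin y = 0 by apply/anti_jlin/lie_ac; [exact: janti_anti|exact:
  uscale_comm].
have hw : lin w = 0 by apply/anti_jlin/lie_ca; [exact: udrift_comm|exact:
  janti_anti].
rewrite -[2^-1 *: t]addr0 !jlin_linear hx ht hy hw ?jlin0 ?janti0.
by rewrite !scaler0 !add0r (addr0 (_ *: t)) -scalerDr.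
Qed.

Lemma janti_so_conn a z :
  anti (nab a z) = (2 * u3)^-1 *: lie (anti a) (lamu z) + lie (drift a) (anti
    z).
Proof.
rewrite so_connE; set x := lie (lin a) _; set y := lie _ (lamu z); set w := lie
  (drift a) _.
set t := lie (anti a) (anti z).
rewrite -[w in LHS]scale1r -addrA -addrA.
have hx : anti x = 0 by apply/comm_janti/lie_cc; exact: jlin_comm.
have ht : anti t = 0 by apply/comm_janti/lie_aa; exact: janti_anti.
have hy : anti y = y by apply/anti_janti/lie_ac; [exact: janti_anti|exact:
  uscale_comm].
have hw : anti w = w by apply/anti_janti/lie_ca; [exact: udrift_comm|exact:
  janti_anti].
rewrite -[2^-1 *: t]addr0 !janti_linear hx ht hy hw ?jlin0 ?janti0.
by rewrite !scaler0 add0r !addr0 scale1r.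
Qed.

Lemma so_conn_torsion a z : nab a z - nab z a = lie a z.
Proof.
rewrite -[in RHS](jlin_janti a) -[in RHS](jlin_janti z) !so_connE udriftE.
move: (lin a) (lin z) (lamu a) (lamu z) (anti a) (anti z) => ap zp al zl am zm;
  lieexpand.
rewrite (lieC zp ap) (lieC zm al) (lieC zl am) (lieC zm am) (lieC zp am).
mxlin; lra.
Qed.

Hypothesis hu3 : u3 != 0.

(** After projection on u(p) and m3 the terms cancel in pairs, because the
    trace form is ad-invariant. The pair inside u(p) also needs that brackets
    have no central part, so that the scale on them is u1. *)
Lemma so_conn_metric a y z :
  \tr (lam (nab a y) *m z) + \tr (lam y *m nab a z) = 0.
Proof.
rewrite (tr_soscale_sym y) !tr_soscale !jlin_so_conn !janti_so_conn.
have := tr_lie_uscale a y z; have := tr_lie_uscale a z y.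
have := tr_lieC (lin a) (lin y) (lin z); have := tr_lieC (drift a) (anti y)
  (anti z).
have := tr_lieC (anti a) (anti y) (lamu z); have := tr_lieC (anti a) (anti z)
  (lamu y).
move: (lie (lin a) (lin y)) (lie (lin a) (lin z)) (lie (anti a) (anti y)) (lie
  (anti a) (anti z)).
move: (lie (anti a) (lamu y)) (lie (anti a) (lamu z)) (lie (drift a) (anti y))
  (lie (drift a) (anti z)).
move=> L5 L6 L7 L8 L1 L2 L3 L4 e4 e3 e2 e1 e6 e5.
rewrite !(mulmxDl, scalerDr) -!scalemxAl; trexpand.
rewrite e6 e5 e4 e3 e2 e1; field.
exact: hu3.
Qed.

(** The Levi-Civita connection of the metric with scales u0, u1, 1, u3. The
    pair (SO(n), SO(k) x SO(q)) is symmetric, so that m2 plays towards so(k)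
    the part that m3 plays towards u(p) and the coefficients have the same
    shape. *)
Definition stiefel_conn (X Y : 'M[R]_(k + q)) : 'M[R]_(k + q) :=
  let a := ulsubmx X in let b := ursubmx X in
  let a' := ulsubmx Y in let b' := ursubmx Y in
  emb (nab a a' + 2^-1 *: (b' *m b^T - b *m b'^T))
      (a *m b' - 2^-1 *: (lam a *m b' + lam a' *m b)).

(** The scale on m2 is normalized to 1. On m2 the form -tr is 2 tr(b^T b'). *)
Definition stiefel_metric (X Y : 'M[R]_(k + q)) : R :=
  ((k + q)%:R - 2) * (2 * \tr ((ursubmx X)^T *m ursubmx Y)
   - \tr (lam (ulsubmx X) *m ulsubmx Y)).

Local Notation conn := stiefel_conn.
Local Notation metric := stiefel_metric.

Lemma ulsub_emb (a : 'M[R]_k) (b : 'M[R]_(k, q)) : ulsubmx (emb a b) = a.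
Proof. exact: block_mxKul. Qed.
Lemma ursub_emb (a : 'M[R]_k) (b : 'M[R]_(k, q)) : ursubmx (emb a b) = b.
Proof. exact: block_mxKur. Qed.

Lemma conn_emb (a a' : 'M[R]_k) (b b' : 'M[R]_(k, q)) :
  conn (emb a b) (emb a' b') =
  emb (nab a a' + 2^-1 *: (b' *m b^T - b *m b'^T))
      (a *m b' - 2^-1 *: (lam a *m b' + lam a' *m b)).
Proof. by rewrite /stiefel_conn !ulsub_emb !ursub_emb. Qed.

Lemma metric_emb (a a' : 'M[R]_k) (b b' : 'M[R]_(k, q)) :
  metric (emb a b) (emb a' b') =
  ((k + q)%:R - 2) * (2 * \tr (b^T *m b') - \tr (lam a *m a')).
Proof. by rewrite /stiefel_metric !ulsub_emb !ursub_emb. Qed.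

Lemma ulsub_linear c (X Y : 'M[R]_(k + q)) :
  ulsubmx (c *: X + Y) = c *: ulsubmx X + ulsubmx Y.
Proof. by apply/matrixP => i j; rewrite !mxE. Qed.
Lemma ursub_linear c (X Y : 'M[R]_(k + q)) :
  ursubmx (c *: X + Y) = c *: ursubmx X + ursubmx Y.
Proof. by apply/matrixP => i j; rewrite !mxE. Qed.

Lemma conn_linearl Y : linear (conn^~ Y).
Proof.
move=> c X X'; rewrite /stiefel_conn ulsub_linear ursub_linear -emb_linear.
rewrite so_conn_linearl soscale_linear; move: (nab _ _) (nab _ _) (lam _) (lam
  _) (lam _).
move: (ulsubmx _) (ulsubmx _) (ursubmx _) (ursubmx _) (ursubmx _) => *.
congr emb; rewrite ?trmxD ?trmxZ; mxexpand; mxlin; ring.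
Qed.

Lemma conn_linearr X : linear (conn X).
Proof.
move=> c Y Y'; rewrite /stiefel_conn ulsub_linear ursub_linear -emb_linear.
rewrite so_conn_linearr soscale_linear; move: (nab _ _) (nab _ _) (lam _) (lam
  _) (lam _).
move: (ulsubmx _) (ursubmx _) (ursubmx _) (ursubmx _) => *.
congr emb; rewrite ?trmxD ?trmxZ; mxexpand; mxlin; ring.
Qed.

Hypothesis hkq : (2 < k + q)%N.

Lemma conn_mm X Y : X \in mm R k q -> Y \in mm R k q -> conn X Y \in mm R k q.
Proof.
move=> /(mmP hkq)[a [b [ha ->]]] /(mmP hkq)[a' [b' [ha' ->]]].
rewrite conn_emb emb_mm // trmxD so_conn_skew // trmxZ trmxD trmxN !trmx_mul
  !trmxK.
by mxlin; ring.
Qed.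

Lemma conn_torsion : torsion_free conn.
Proof.
move=> X Y /(mmP hkq)[a [b [ha ->]]] /(mmP hkq)[a' [b' [ha' ->]]].
rewrite pr_m_lie // !conn_emb -so_conn_torsion.
rewrite (addrC (emb _ _)) -scaleN1r -emb_linear; congr emb; mxlin; lra.
Qed.

Lemma mxtrace_trC m n (A B : 'M[R]_(m, n)) : \tr (A^T *m B) = \tr (B^T *m A).
Proof. by rewrite -mxtrace_tr trmx_mul trmxK. Qed.

Lemma mxtrace_skewC n (s : 'M[R]_k) (A B : 'M[R]_(k, n)) : s^T = - s ->
  \tr (A^T *m s *m B) = - \tr (B^T *m s *m A).
Proof.
by move=> hs; rewrite -mxtrace_tr !trmx_mul trmxK hs mulNmx mulmxN mxtraceN
  mulmxA.
Qed.

Lemma tr_skew_ul n (t : 'M[R]_k) (b c : 'M[R]_(k, n)) :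
  \tr (t *m (c *m b^T - b *m c^T)) = \tr (b^T *m t *m c) - \tr (c^T *m t *m b).
Proof.
by rewrite mulmxBr mxtraceD mxtraceN !mulmxA (mxtrace_mulC _ b^T) (mxtrace_mulC
  _ c^T) !mulmxA.
Qed.

Lemma tr_skew_ur n (a p s : 'M[R]_k) (b c d : 'M[R]_(k, n)) :
  a^T = - a -> p^T = - p -> s^T = - s ->
  \tr ((a *m c - 2^-1 *: (p *m c + s *m b))^T *m d) =
  - \tr (c^T *m a *m d) + 2^-1 * (\tr (c^T *m p *m d) + \tr (b^T *m s *m d)).
Proof.
move=> ha hpp hs; rewrite !(trmxD, trmxN, trmxZ, trmx_mul) ha hpp hs.
rewrite !(mulmxDl, mulNmx, mulmxN) -scalemxAl !(mulmxDl, mulNmx).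
by trexpand; ring.
Qed.

Lemma conn_metric : metric_connection metric conn.
Proof.
move=> X Y Z /(mmP hkq)[a [b [ha ->]]] /(mmP hkq)[y [c [hy ->]]] /(mmP hkq)[z
  [d [hz ->]]].
rewrite !conn_emb !metric_emb -mulrDr.
apply/eqP; rewrite mulf_eq0; apply/orP; right; apply/eqP.
rewrite (mxtrace_trC c) (tr_soscale_sym _ z) !mulmxDr !mxtraceD (tr_soscale_sym
  z).
have he := so_conn_metric a y z.
rewrite -![lam _ *m (2^-1 *: _)]scalemxAr !mxtraceZ.
rewrite !tr_skew_ur ?soscale_skew // !tr_skew_ul.
rewrite (mxtrace_skewC d c ha) (mxtrace_skewC d c (soscale_skew ha)).
rewrite (mxtrace_skewC c b (soscale_skew hz)) (mxtrace_skewC d b (soscale_skew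
  hy)).
lra.
Qed.
End Conn.

Section Inv.
Variables (R : realType) (k q : nat).

Lemma invmx_orth n (A : 'M[R]_n) : A^T *m A = 1%:M -> invmx A = A^T.
Proof.
move=> h; have [_ uA] := mulmx1_unit h.
by rewrite -[LHS]mul1mx -h -mulmxA mulmxV // mulmx1.
Qed.

Lemma Ad_emb (A : 'M[R]_k) (C : 'M[R]_q) a b :
  A^T *m A = 1%:M -> C^T *m C = 1%:M ->
  Ad (block_mx A 0 0 C) (emb a b) = emb (A *m a *m A^T) (A *m b *m C^T).
Proof.
move=> hA hC; rewrite /Ad invmx_orth; last first.
  rewrite tr_block_mx mulmx_block !trmx0 !(mulmx0, mul0mx, addr0, add0r) hA hC.
  by rewrite -scalar_mx_block.
rewrite /emb tr_block_mx !mulmx_block !trmx0 !(mulmx0, mul0mx, addr0, add0r).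
by rewrite !trmx_mul trmxK mulmxN !mulNmx !mulmxA.
Qed.

Variable J : 'M[R]_k.
Hypotheses (hJT : J^T = - J) (hJJ : J *m J = - 1%:M).
Variables u0 u1 u3 : R.
Local Notation lin := (jlin J).
Local Notation anti := (janti J).
Local Notation cen := (jcenter J).
Local Notation lamu := (uscale J u0 u1).
Local Notation lam := (soscale J u0 u1 u3).
Local Notation conn := (@stiefel_conn R k q J u0 u1 u3).
Local Notation metric := (@stiefel_metric R k q J u0 u1 u3).
Hypothesis hkq : (2 < k + q)%N.

(** Conjugation by an orthogonal matrix commuting with J fixes J, hence
    respects the splitting of so(k) into m0, m1 and m3. *)
Lemma soscale_equivariant (A : 'M[R]_k) a :
  A^T *m A = 1%:M -> J *m A = A *m J ->
  lam (A *m a *m A^T) = A *m lam a *m A^T.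
Proof.
move=> hA hAJ.
have hJA : A^T *m J = J *m A^T.
  by apply: trmx_inj; rewrite !trmx_mul hJT trmxK mulNmx mulmxN hAJ.
have e x : J *m (A *m x *m A^T) *m J = A *m (J *m x *m J) *m A^T.
  by rewrite !mulmxA hAJ -!mulmxA hJA.
have et x : \tr (A *m x *m A^T *m J) = \tr (x *m J).
  by rewrite -(mulmxA (A *m x)) hJA mulmxA mxtrace_mulC !mulmxA hA mul1mx.
have eJ : A *m J *m A^T = J by rewrite -hAJ -mulmxA (mulmx1C hA) mulmx1.
rewrite !soscaleE !uscaleE !jantiE !jlinE !jcenterE e et.
rewrite ?(mulmxDl, mulmxDr, mulNmx, mulmxN, =^~ scalemxAl, =^~ scalemxAr) eJ.
by [].
Qed.

Lemma metric_invariant (K : 'M[R]_k -> Prop) :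
  (forall A, K A -> A^T *m A = 1%:M /\
    forall a, lam (A *m a *m A^T) = A *m lam a *m A^T) ->
  Ad_invariant K metric.
Proof.
move=> hK A C /hK[hA hlam] [hC _] X Y /(mmP hkq)[a [b [ha ->]]] /(mmP hkq)[a'
  [b' [ha' ->]]].
rewrite !Ad_emb // !metric_emb hlam; congr (_ * (_ * _ - _)).
  rewrite !trmx_mul trmxK -!mulmxA (mulmxA A^T) hA mul1mx mxtrace_mulC.
  by rewrite -!mulmxA hC mulmx1.
by rewrite -!mulmxA (mulmxA A^T) hA mul1mx mxtrace_mulC -!mulmxA hA mulmx1.
Qed.

Lemma soscale_const a x : soscale J x x x a = x *: a.
Proof.
rewrite -[in RHS](jlin_janti J a) soscaleE uscaleE subrr scale0r addr0.
by rewrite scalerDr.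
Qed.

Lemma conn_invariant : invariant_connection conn.
Proof.
split.
- by move=> X Y hX hY; apply: conn_mm.
- by move=> X Y Z _ _ _ a; apply: conn_linearl.
- by move=> X Y Z _ _ _ a; apply: conn_linearr.
move=> C [hC _] X Y /(mmP hkq)[a [b [ha ->]]] /(mmP hkq)[a' [b' [ha' ->]]].
have h1 : (1%:M : 'M[R]_k)^T *m 1%:M = 1%:M by rewrite trmx1 mulmx1.
rewrite conn_emb !Ad_emb // !trmx1 !mulmx1 !mul1mx conn_emb.
congr emb; last by rewrite mulmxBl -scalemxAl mulmxDl !mulmxA.
congr (_ + _ *: (_ - _)).
  by rewrite trmx_mul trmxK -!mulmxA (mulmxA C^T) hC mul1mx.
by rewrite trmx_mul trmxK -!mulmxA (mulmxA C^T) hC mul1mx.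
Qed.

Hypothesis hk : (0 < k)%N.
Hypotheses (hu0 : 0 < u0) (hu1 : 0 < u1) (hu3 : 0 < u3).

Lemma conn_levi_civita : levi_civita metric conn.
Proof.
split; first exact: conn_invariant.
  exact: conn_torsion.
by apply: conn_metric => //; rewrite gt_eqF.
Qed.

Lemma tr_jlin_jcenter a b :
  \tr (lin a *m cen b) = - (\tr (a *m J) * \tr (b *m J) / k%:R).
Proof.
rewrite mxtrace_mulC tr_jcenter; have -> : \tr (lin a *m J) = \tr (a *m J);
  last by ring.
by rewrite -[in RHS](jlin_janti J a) mulmxDl mxtraceD (anti_trJ (janti_anti hJJ
  a)) addr0.
Qed.

Lemma tr_jcenter_jcenter a b :
  \tr (cen a *m cen b) = - (\tr (a *m J) * \tr (b *m J) / k%:R).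
Proof.
rewrite tr_jcenter; congr (- (_ * _ / _)).
rewrite jcenterE -scalemxAl hJJ mxtraceZ mxtraceN mxtrace1 mulrNN mulfVK //.
by rewrite pnatr_eq0 -lt0n.
Qed.

(** The sum over m1, m0 and m3: minus this is a positive combination of
    squared norms. *)
Lemma tr_soscale_sq a : \tr (lam a *m a) =
  u1 * \tr ((lin a - cen a) *m (lin a - cen a)) + u0 * \tr (cen a *m cen a)
  + u3 * \tr (anti a *m anti a).
Proof.
rewrite (tr_soscale hJJ) uscaleE !(mulmxDl, mulmxDr, mulNmx, mulmxN)
  -!scalemxAr.
trexpand; rewrite (mxtrace_mulC (cen a) (lin a)) !tr_jcenter_jcenter
  !tr_jlin_jcenter.
ring.
Qed.

Lemma tr_skew_sq_le0 (s : 'M[R]_k) : s^T = - s -> \tr (s *m s) <= 0.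
Proof.
by move=> hs; rewrite -oppr_ge0 -mxtraceN -mulNmx -hs mxtrace_tr_mul_ge0.
Qed.

Lemma tr_skew_sq_eq0 (s : 'M[R]_k) : s^T = - s -> \tr (s *m s) = 0 -> s = 0.
Proof.
move=> hs h; apply: mxtrace_tr_mul_eq0.
by rewrite hs mulNmx mxtraceN h oppr0.
Qed.

Lemma metric_scalar_product : scalar_product metric.
Proof.
split.
- move=> X Y /(mmP hkq)[a [b [ha ->]]] /(mmP hkq)[a' [b' [ha' ->]]].
  by rewrite !metric_emb (tr_soscale_sym hJJ) mxtrace_trC.
- move=> X Y Z /(mmP hkq)[a [b [ha ->]]] /(mmP hkq)[a' [b' [ha' ->]]] _ c.
  rewrite -emb_linear /stiefel_metric !ulsub_emb !ursub_emb soscale_linear.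
  rewrite trmxD trmxZ !mulmxDl -!scalemxAl; trexpand; ring.
move=> X /(mmP hkq)[a [b [ha ->]]] nz.
rewrite metric_emb pmulr_rgt0 ?dim_gt2 //.
have s1 : (lin a - cen a)^T = - (lin a - cen a).
  by rewrite trmxD trmxN jlin_skew // jcenter_skew // opprD.
have s0 := jcenter_skew hJT a; have s3 := janti_skew hJT ha.
have hb := mxtrace_tr_mul_ge0 b.
have h1 := tr_skew_sq_le0 s1; have h0 := tr_skew_sq_le0 s0; have h3 :=
  tr_skew_sq_le0 s3.
have k1 := h1; have k0 := h0; have k3 := h3.
rewrite -(pmulr_rle0 _ hu1) in k1; rewrite -(pmulr_rle0 _ hu0) in k0.
rewrite -(pmulr_rle0 _ hu3) in k3.
rewrite tr_soscale_sq lt_neqAle; apply/andP; split; last by lra.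
apply: contra nz => /eqP h.
have [m1 m0 m3 zb] : [/\ u1 * \tr ((lin a - cen a) *m (lin a - cen a)) = 0,
   u0 * \tr (cen a *m cen a) = 0, u3 * \tr (anti a *m anti a) = 0 & \tr (b^T *m
     b) = 0].
  by split; lra.
have z0 u t : 0 < u -> u * t = 0 :> R -> t = 0.
  by move=> hu /eqP; rewrite mulf_eq0 gt_eqF //= => /eqP.
have := tr_skew_sq_eq0 s1 (z0 _ _ hu1 m1).
rewrite (tr_skew_sq_eq0 s0 (z0 _ _ hu0 m0)) subr0 => p10.
rewrite -(jlin_janti J a) p10 (tr_skew_sq_eq0 s3 (z0 _ _ hu3 m3))
  (mxtrace_tr_mul_eq0 zb).
by rewrite add0r /emb linear0 oppr0 block_mx0.
Qed.

Lemma metric_invariant_metric : invariant_metric metric.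
Proof.
split; first exact: metric_scalar_product.
by apply: metric_invariant => A ->; rewrite trmx1 mulmx1; split=> // a; rewrite
  !mul1mx !mulmx1.
Qed.
End Inv.

(** * Traces over so(k) *)

Section SoTraces.
Variables (R : realType) (k : nat).
Implicit Types M N x y z : 'M[R]_k.

Lemma mxtrace_skew0 x : x^T = - x -> \tr x = 0.
Proof. by move=> h; apply/eqP; rewrite -eqNr -mxtraceN -h mxtrace_tr. Qed.

Lemma strace_skew_mul M N :
  strace (fun X => M *m skew X *m N) = 2^-1 * (\tr M * \tr N - \tr (M^T *m N)).
Proof.
rewrite -strace_mul -strace_mul_tr -straceN -straceD -straceZ.
apply: eq_strace => X; rewrite /skew.
by rewrite -scalemxAr -scalemxAl mulmxBr mulmxBl.
Qed.

Lemma strace_skew_mull M :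
  strace (fun X => M *m skew X) = 2^-1 * (k%:R - 1) * \tr M.
Proof.
have -> : strace (fun X => M *m skew X) = strace (fun X => M *m skew X *m 1%:M).
  by apply: eq_strace => X; rewrite mulmx1.
by rewrite strace_skew_mul mxtrace1 mulmx1 mxtrace_tr; ring.
Qed.

Lemma strace_skew_mulr N :
  strace (fun X => skew X *m N) = 2^-1 * (k%:R - 1) * \tr N.
Proof.
have -> : strace (fun X => skew X *m N) = strace (fun X => 1%:M *m skew X *m N).
  by apply: eq_strace => X; rewrite mul1mx.
by rewrite strace_skew_mul mxtrace1 trmx1 mul1mx; ring.
Qed.

Variable J : 'M[R]_k.
Hypotheses (hJT : J^T = - J) (hJJ : J *m J = - 1%:M).

Lemma mxtrace_J0 : \tr J = 0. Proof. exact: mxtrace_skew0. Qed.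

(** For skew X the trace of X J sees only the component along J, so this
    operator has rank one and its trace is a single value. *)
Lemma strace_skew_trJ (A : 'M[R]_k) :
  strace (fun X => \tr (skew X *m J) *: A) = \tr (A *m J).
Proof.
rewrite (@strace_rank1 _ _ _ (fun X => \tr (skew X *m J))).
  rewrite /skew -scalemxAl mxtraceZ mulmxBl mxtraceD mxtraceN mxtrace_trC hJT.
  by rewrite mulNmx mxtraceN (mxtrace_mulC J) opprK; lra.
move=> c X Y; rewrite skew_linear mulmxDl -scalemxAl.
by rewrite mxtraceD mxtraceZ.
Qed.

Lemma lie_lieE x z y :
  lie (lie x z) y = x *m (z *m y) - z *m x *m y - y *m x *m z + (y *m z) *m x.
Proof. by rewrite /lie !(mulmxBl, mulmxBr) !mulmxA; mxlin; ring. Qed.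

Lemma lie_lieZ c x z y : lie (lie (c *: x) z) y = c *: lie (lie x z) y.
Proof. by rewrite (lieZl c x z) lieZl. Qed.
Lemma lie_lieD x x' z y :
  lie (lie (x + x') z) y = lie (lie x z) y + lie (lie x' z) y.
Proof. by rewrite (lieDl x x' z) lieDl. Qed.
Lemma lie_lieN x z y : lie (lie (- x) z) y = - lie (lie x z) y.
Proof. by rewrite (lieNl x z) lieNl. Qed.

(** This is the Killing form of so(k). *)
Lemma strace_ad_ad z y : z^T = - z -> y^T = - y ->
  strace (fun X => lie (lie (skew X) z) y) = (k%:R - 2) * \tr (z *m y).
Proof.
move=> hz hy.
rewrite (eq_strace (fun X => lie_lieE (skew X) z y)).
rewrite !straceD !straceN !strace_skew_mul strace_skew_mulr strace_skew_mull.
rewrite hz hy !mulNmx !mxtraceN !(mxtrace_skew0 hz) !(mxtrace_skew0 hy)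
  (mxtrace_mulC y).
by field.
Qed.

(** The trace of ad y ad z twisted by X |-> J X J; with the Killing form it
    gives the separate traces over u(p) and m3, since the projections are (1 -
    J.J) / 2 and (1 + J.J) / 2. *)
Lemma strace_J_ad_ad z y : z^T = - z -> y^T = - y ->
  strace (fun X => lie (lie (J *m skew X *m J) z) y) =
  - \tr (z *m y) - \tr (z *m J) * \tr (y *m J) + \tr (J *m z *m J *m y).
Proof.
move=> hz hy.
have e X : lie (lie (J *m skew X *m J) z) y =
   J *m skew X *m (J *m z *m y) - (z *m J) *m skew X *m (J *m y)
   - (y *m J) *m skew X *m (J *m z) + (y *m z *m J) *m skew X *m J.
  by rewrite lie_lieE !mulmxA.
rewrite (eq_strace e) !straceD !straceN !strace_skew_mul !trmx_mul hJT hz hy.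
rewrite !(mulmxN, mulNmx, opprK) !mxtraceN mxtrace_J0.
rewrite !mulmxA hJJ !(mulmxN, mulNmx) !mul1mx !mxtraceN.
rewrite (mxtrace_mulC J y) (mxtrace_mulC J z).
have -> : \tr (J *m z *m y *m J) = - \tr (z *m y).
  by rewrite mxtrace_mulC !mulmxA hJJ !mulNmx mul1mx mxtraceN.
have -> : \tr (J *m y *m J *m z) = \tr (J *m z *m J *m y).
  by rewrite -mulmxA mxtrace_mulC !mulmxA.
lra.
Qed.

Local Notation lin := (jlin J).
Local Notation anti := (janti J).
Local Notation cen := (jcenter J).

Lemma comm_JzJ z : J *m z = z *m J -> J *m z *m J = - z.
Proof. by move=> h; rewrite h mulJJ. Qed.
Lemma anti_JzJ z : J *m z = - (z *m J) -> J *m z *m J = z.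
Proof. by move=> h; rewrite h mulNmx mulJJ // opprK. Qed.

Section Comm.
Variables z y : 'M[R]_k.
Hypotheses (hz : z^T = - z) (hy : y^T = - y).

Lemma strace_jlin_ad : strace (fun X => lie (lie (lin (skew X)) z) y) =
  2^-1 * (strace (fun X => lie (lie (skew X) z) y)
         - strace (fun X => lie (lie (J *m skew X *m J) z) y)).
Proof.
rewrite -straceN -straceD -straceZ; apply: eq_strace => X.
by rewrite jlinE; move: (skew X) => s; rewrite lie_lieZ lie_lieD lie_lieN.
Qed.

Lemma strace_janti_ad : strace (fun X => lie (lie (anti (skew X)) z) y) =
  2^-1 * (strace (fun X => lie (lie (skew X) z) y)
         + strace (fun X => lie (lie (J *m skew X *m J) z) y)).
Proof.
rewrite -straceD -straceZ; apply: eq_strace => X.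
by rewrite jantiE; move: (skew X) => s; rewrite lie_lieZ lie_lieD.
Qed.

Lemma strace_jcenter_ad : strace (fun X => lie (lie (cen (skew X)) z) y) =
  - k%:R^-1 * \tr (lie (lie J z) y *m J).
Proof.
rewrite -strace_skew_trJ -straceZ; apply: eq_strace => X.
by rewrite jcenterE lie_lieZ scalerA; congr (_ *: _); ring.
Qed.

Lemma strace_jlin_ad_comm : J *m z = z *m J ->
  strace (fun X => lie (lie (lin (skew X)) z) y) =
  k%:R / 2 * \tr (z *m y) + 2^-1 * (\tr (z *m J) * \tr (y *m J)).
Proof.
move=> cz; rewrite strace_jlin_ad strace_ad_ad // strace_J_ad_ad // comm_JzJ //
  mulNmx.
by rewrite mxtraceN; field.
Qed.

Lemma strace_janti_ad_comm : J *m z = z *m J ->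
  strace (fun X => lie (lie (anti (skew X)) z) y) =
  2^-1 * ((k%:R - 4) * \tr (z *m y) - \tr (z *m J) * \tr (y *m J)).
Proof.
move=> cz; rewrite strace_janti_ad strace_ad_ad // strace_J_ad_ad // comm_JzJ
  // mulNmx.
by rewrite mxtraceN; field.
Qed.

Lemma strace_jlin_ad_anti : J *m z = - (z *m J) ->
  strace (fun X => lie (lie (lin (skew X)) z) y) = (k%:R - 2) / 2 * \tr (z *m
    y).
Proof.
move=> cz; rewrite strace_jlin_ad strace_ad_ad // strace_J_ad_ad // anti_JzJ //.
by rewrite (anti_trJ cz); field.
Qed.

Lemma strace_jcenter_ad_anti : J *m z = - (z *m J) ->
  strace (fun X => lie (lie (cen (skew X)) z) y) = 4 / k%:R * \tr (z *m y).
Proof.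
move=> cz; rewrite strace_jcenter_ad.
have -> : lie J z = 2%:R *: (J *m z).
  by rewrite /lie -(opprK (z *m J)) -cz opprK scaler_nat mulr2n.
rewrite lieZl -scalemxAl mxtraceZ /lie mulmxBl mxtraceD mxtraceN.
have -> : \tr (y *m (J *m z) *m J) = \tr (z *m y).
  by rewrite -mulmxA anti_JzJ // mxtrace_mulC.
have -> : \tr (J *m z *m y *m J) = - \tr (z *m y).
  by rewrite mxtrace_mulC !mulmxA hJJ !mulNmx mul1mx mxtraceN.
by ring.
Qed.

End Comm.

Lemma strace_jlin_lie0 w :
  w^T = - w -> strace (fun X => lie (lin (skew X)) w) = 0.
Proof.
move=> hw.
have e X : lie (lin (skew X)) w = 2^-1 *: (skew X *m w - w *m skew X
   + (- (J *m skew X *m (J *m w)) + w *m J *m skew X *m J)).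
  rewrite jlinE lieZl /lie; congr (_ *: _); rewrite mulmxBl mulmxBr opprB
    !mulmxA.
  by mxlin; ring.
rewrite (eq_strace e) straceZ !straceD !straceN strace_skew_mull
  strace_skew_mulr.
rewrite !strace_skew_mul !trmx_mul hJT hw mxtrace_J0 (mxtrace_skew0 hw).
have -> : - J *m (J *m w) = w by rewrite mulNmx mulJJl // opprK.
have -> : \tr (- J *m - w *m J) = - \tr w.
  by rewrite mxtrace_mulC !(mulNmx, mulmxN) opprK mulJJl // mxtraceN.
by rewrite (mxtrace_skew0 hw); ring.
Qed.

Lemma strace_janti_lie0 w :
  w^T = - w -> strace (fun X => lie (anti (skew X)) w) = 0.
Proof.
move=> hw.
have e X : lie (anti (skew X)) w = skew X *m w + - (w *m skew X) + - lie (lin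
  (skew X)) w.
  by rewrite -[_ *m w + _]/(lie (skew X) w) -{2}(jlin_janti J (skew X)) lieDl
    addrAC subrr add0r.
rewrite (eq_strace e) !straceD !straceN (strace_jlin_lie0 hw).
rewrite strace_skew_mull strace_skew_mulr; ring.
Qed.

Lemma strace_jcenter_lie0 w : strace (fun X => lie (cen (skew X)) w) = 0.
Proof.
have -> : 0 = - k%:R^-1 * \tr (lie J w *m J) :> R.
  by rewrite /lie mulmxBl mxtraceD mxtraceN (mxtrace_mulC (w *m J) J) mulmxA
    subrr mulr0.
rewrite -strace_skew_trJ -straceZ; apply: eq_strace => X.
by rewrite jcenterE !lieZl scalerA; congr (_ *: _); ring.
Qed.

End SoTraces.

(** * The Ricci tensor *)

Section Ricci.
Variables (R : realType) (k q : nat).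
Hypotheses (hk : (0 < k)%N) (hkq : (2 < k + q)%N).

Section Reduction.
Variable L : connection_map R k q.
Hypothesis Ll : forall Y, linear (L^~ Y).
Hypothesis LV : {in mm R k q &, forall X Y, L X Y \in mm R k q}.
Hypothesis Ltf : torsion_free L.
Hypothesis Ltr : {in mm R k q, forall W, trace_on (mm R k q) (L^~ W) = 0}.

Lemma pr_m_mm X : pr_m R k q X \in mm R k q.
Proof. exact: memv_pi. Qed.

(** In R(X,Y)Z the term L(X)L(Y)Z has trace zero. Replacing L(Y)V by L(V)Y +
    [Y,V]_m for V = L(X)Z turns the second term into -L(L(X)Z)Y - [Y,
    L(X)Z]_m, and the trace of the last piece cancels that of -L([X,Y]_m)Z by
    cyclicity. So Ric is, up to the isotropy term, minus the trace of a
    product of two operators X |-> L(X)Y and X |-> L(X)Z, which is easy to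
    compute block by block. *)
Lemma Ric_trace : {in mm R k q &, forall Y Z,
  Ric L Y Z = - trace_on (mm R k q) (fun X => L (L X Z) Y)
   - trace_on (mm R k q) (fun X => lie (pr_h R k q (lie X Y)) Z)}.
Proof.
move=> Y Z hY hZ; rewrite /Ric.
pose A X := pr_m R k q (lie X Y).
have hA : linear A by move=> c X X'; rewrite /A lie_linearl linearP.
have e : {in mm R k q, (fun X => curvature L X Y Z) =1 (fun X =>
   L X (L Y Z) + - L (L X Z) Y + A (L X Z) + - L (A X) Z
   + - lie (pr_h R k q (lie X Y)) Z)}.
  move=> X hX; rewrite /curvature /A; congr (_ + - _ - _).
  rewrite -addrA; congr (_ + _).
  by rewrite -(Ltf (LV hX hZ) hY) addKr.
rewrite (eq_trace_on e) 4!trace_onD 3!trace_onN (Ltr (LV hY hZ)) add0r.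
rewrite (trace_onC (f := A) (g := L^~ Z)) //; first by rewrite addrK.
- by move=> X _; apply: pr_m_mm.
- by move=> X hX; apply: LV.
Qed.
End Reduction.

Variable J : 'M[R]_k.
Hypotheses (hJT : J^T = - J) (hJJ : J *m J = - 1%:M).
Variables u0 u1 u3 : R.
Hypothesis hu3 : u3 != 0.
Local Notation lin := (jlin J).
Local Notation anti := (janti J).
Local Notation cen := (jcenter J).
Local Notation lamu := (uscale J u0 u1).
Local Notation lam := (soscale J u0 u1 u3).
Local Notation drift := (udrift J u0 u1 u3).
Local Notation nab := (so_conn J u0 u1 u3).
Local Notation conn := (@stiefel_conn R k q J u0 u1 u3).
Local Notation metric := (@stiefel_metric R k q J u0 u1 u3).

Lemma linear_map0 (U V : lmodType R) (f : U -> V) : linear f -> f 0 = 0.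
Proof.
by move=> hf; have := hf (-1) 0 0; rewrite scaler0 add0r scaleN1r addNr.
Qed.

Lemma soscale0 :
  lam 0 = 0.
Proof. exact: linear_map0 (@soscale_linear _ _ _ _ _ _). Qed.
Lemma so_conn0l z :
  nab 0 z = 0.
Proof. exact: linear_map0 (@so_conn_linearl _ _ _ _ _ _ z). Qed.
(** Brackets with a traceless skew matrix, projected or not, have trace zero:
    this is unimodularity of the group. *)
Lemma strace_so_conn w : w^T = - w -> strace (fun a => nab (skew a) w) = 0.
Proof.
move=> hw.
have e a : nab (skew a) w = 2^-1 *: lie (lin (skew a)) (lin w)
   + (2 * u3)^-1 *: lie (anti (skew a)) (lamu w)
   + ((1 - u1 / (2 * u3)) *: lie (lin (skew a)) (anti w)
      + - ((u0 - u1) / (2 * u3)) *: lie (cen (skew a)) (anti w))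
   + 2^-1 *: lie (anti (skew a)) (anti w).
  rewrite so_connE udriftE uscaleE; congr (_ + _ + _).
  move: (lin _) (cen _) (anti _) => x y z.
  rewrite lieDl lieNl lieZl (lieDl (u1 *: x)) (lieZl u1) (lieZl (_ - _)).
  by move: (lie x z) (lie y z) => s t; mxlin; field.
rewrite (eq_strace e) !straceD !straceZ.
rewrite !(strace_jlin_lie0 hJT hJJ) ?(strace_janti_lie0 hJT hJJ)
  ?strace_jcenter_lie0 //;
  rewrite ?jlin_skew ?janti_skew ?uscale_skew //.
by rewrite !mulr0 !addr0.
Qed.

Lemma conn_emb_so a z (c : 'M[R]_(k, q)) :
  conn (emb a 0) (emb z c) = emb (nab a z) (a *m c - 2^-1 *: (lam a *m c)).
Proof.
by rewrite conn_emb trmx0 !mulmx0 mul0mx subrr scaler0 !addr0.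
Qed.

Lemma conn_emb_m2 b z (c : 'M[R]_(k, q)) :
  conn (emb 0 b) (emb z c) =
  emb (2^-1 *: (c *m b^T - b *m c^T)) (- 2^-1 *: (lam z *m b)).
Proof.
by rewrite conn_emb so_conn0l add0r soscale0 !mul0mx !add0r -scaleNr.
Qed.

Lemma trace_conn W : W \in mm R k q -> trace_on (mm R k q) (conn^~ W) = 0.
Proof.
move=> hW; rewrite trace_on_mm //; last first.
- by move=> X hX; apply: conn_mm.
- exact: conn_linearl.
case/(mmP hkq): hW => w [c [hw ->]].
rewrite (eq_strace (G := fun a => nab (skew a) w)); last first.
  by move=> a; rewrite conn_emb_so ulsub_emb.
rewrite strace_so_conn // add0r.
rewrite (eq_strace (G := fun b => - 2^-1 *: (lam w *m b))); last first.
  by move=> b; rewrite conn_emb_m2 ursub_emb.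
by rewrite straceZ strace_mull mxtrace_skew0 ?soscale_skew // !mulr0.
Qed.

(** On m2 the connection involves 1 - soscale / 2; it is written through the
    elementary operators whose traces are known. *)
Lemma half_lamE a : a - 2^-1 *: lam a =
  (1 - (u1 + u3) / 4) *: a + ((u1 - u3) / 4) *: (J *m a *m J)
   + ((u0 - u1) / (2 * k%:R) * \tr (a *m J)) *: J.
Proof.
have k0 : k%:R != 0 :> R by rewrite pnatr_eq0 -lt0n.
by rewrite soscaleE uscaleE jlinE jantiE jcenterE; mxlin; field.
Qed.

(** Minus the trace over so(k) of a |-> S (1 - soscale / 2)(a) + (1 - soscale
    / 2)(a) S, divided by tr S, for symmetric S. *)
Definition mixed_coef := (1 - (u1 + u3) / 4) * (1 - k%:R) + (u1 - u3) / 4 + (u0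
  - u1) / k%:R.

Lemma strace_mixed (b c : 'M[R]_(k, q)) :
  strace (fun x : 'M[R]_(k, q) => let w := 2^-1 *: (c *m x^T - x *m c^T) in
     (w - 2^-1 *: lam w) *m b) = 2^-1 * mixed_coef * \tr (c^T *m b).
Proof.
have e x : (let w := 2^-1 *: (c *m x^T - x *m c^T) in (w - 2^-1 *: lam w) *m b)
  =
  ((1 - (u1 + u3) / 4) / 2) *: (c *m x^T *m b - x *m (c^T *m b))
  + ((u1 - u3) / 4 / 2) *: ((J *m c) *m x^T *m (J *m b) - J *m x *m (c^T *m (J
    *m b)))
  + ((u0 - u1) / (2 * k%:R) / 2) *: (\tr ((c *m x^T - x *m c^T) *m J) *: (J *m
    b)).
  rewrite /= half_lamE !mulmxDl -!scalemxAl -!scalemxAr -!scalemxAl mxtraceZ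
    !scalerA.
  congr (_ + _ + _).
  - by rewrite mulmxBl !mulmxA.
  - by rewrite mulmxBr !mulmxBl !mulmxA.
  - by congr (_ *: _); rewrite !mulmxDl !mulNmx; ring.
rewrite (eq_strace e) !straceD !straceZ !straceD !straceN !strace_mul_tr
  strace_mulr.
rewrite strace_mul (mxtrace_J0 hJT).
rewrite (@strace_rank1 _ _ _ (fun x : 'M[R]_(k, q) => \tr ((c *m x^T - x *m
  c^T) *m J))); last first.
  move=> a x y; rewrite trmxD trmxZ.
  rewrite ?(mulmxDl, mulmxDr, mulNmx, mulmxN, =^~ scalemxAl, =^~ scalemxAr).
  by trexpand; rewrite /GRing.scale /=; ring.
rewrite !trmx_mul hJT !mulmxN !mulNmx.
have k0 : k%:R != 0 :> R by rewrite pnatr_eq0 -lt0n.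
have -> : \tr (- (c^T *m J *m (J *m b))) = \tr (c^T *m b).
  by rewrite -mulmxA (mulJJl hJJ) mulmxN opprK.
have -> : \tr ((- (c *m (b^T *m J)) - J *m b *m c^T) *m J) = 2 * \tr (c^T *m b).
  rewrite mulmxBl mulNmx mxtraceD !mxtraceN mulmxA (mulJJ hJJ) mxtraceN.
  rewrite (mxtrace_mulC _ J) !mulmxA hJJ !mulNmx mul1mx mxtraceN.
  by rewrite (mxtrace_mulC b) (mxtrace_mulC c) mxtrace_trC; ring.
by rewrite /mixed_coef; field.
Qed.

(** By cyclicity this is the trace over m2 of [strace_mixed], with b and c
    exchanged. *)
Lemma strace_mixed_so (b c : 'M[R]_(k, q)) :
  strace (fun a => let d := skew a *m c - 2^-1 *: (lam (skew a) *m c) in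
     2^-1 *: (b *m d^T - d *m b^T)) = 2^-1 * mixed_coef * \tr (b^T *m c).
Proof.
pose F (a : 'M[R]_k) := skew a *m c - 2^-1 *: (lam (skew a) *m c).
pose G (d : 'M[R]_(k, q)) := 2^-1 *: (b *m d^T - d *m b^T).
have lF : linear F.
  move=> x a a'; rewrite /F skew_linear soscale_linear.
  by rewrite !mulmxDl -!scalemxAl; mxlin; ring.
have lG : linear G.
  move=> x a a'; rewrite /G trmxD trmxZ mulmxDl mulmxDr -scalemxAl -scalemxAr.
  by mxlin; ring.
rewrite (@eq_strace _ _ _ _ (fun a => G (F a))) // (straceC lG lF)
  -strace_mixed.
apply: eq_strace => x; rewrite /F skew_id; first by rewrite /= [RHS]mulmxBl
  -(scalemxAl _ (lam _)).
by rewrite /G trmxZ trmxD trmxN !trmx_mul !trmxK -scalerN opprB.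
Qed.

Lemma udrift_jlin x : drift x = drift (lin x).
Proof.
rewrite !udriftE !uscaleE (comm_jlin hJJ (jlin_comm hJJ x)); congr (_ - _ *: (_
  + _ *: _)).
rewrite !jcenterE -{1}(jlin_janti J x) mulmxDl mxtraceD (anti_trJ (janti_anti
  hJJ x)) addr0.
by [].
Qed.

Lemma udrift0 :
  drift 0 = 0.
Proof. exact: linear_map0 (@udrift_linear _ _ _ _ _ _). Qed.
Lemma jlin_skewC X : lin (skew X) = skew (lin X).
Proof.
rewrite jlinE /skew trmxZ trmxD trmxN !trmx_mul hJT !(mulmxN, mulNmx, opprK)
  ?mulmxA.
rewrite ?(mulmxDl, mulmxDr, mulNmx, mulmxN, =^~ scalemxAl, =^~ scalemxAr).
by mxlin; ring.
Qed.
Lemma janti_skewC X : anti (skew X) = skew (anti X).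
Proof.
by apply: (addrI (lin (skew X))); rewrite jlin_janti jlin_skewC -[LHS](congr1 _
  (jlin_janti J X))
  -[lin X]scale1r skew_linear !scale1r.
Qed.
Lemma jlin_idem x :
  lin (lin x) = lin x.
Proof. exact: comm_jlin (jlin_comm hJJ x). Qed.
Lemma janti_idem x :
  anti (anti x) = anti x.
Proof. exact: anti_janti (janti_anti hJJ x). Qed.
Lemma jlin_janti0 x :
  lin (anti x) = 0.
Proof. exact: anti_jlin (janti_anti hJJ x). Qed.
Lemma janti_jlin0 x :
  anti (lin x) = 0.
Proof. exact: comm_janti (jlin_comm hJJ x). Qed.

(** The trace of an operator on so(k) is the sum of the traces of its diagonal
    blocks for so(k) = u(p) + m3. *)
Lemma strace_blocks (F : 'M[R]_k -> 'M[R]_k) : linear F ->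
  strace (fun X => F (skew X)) =
    strace (fun X => lin (F (lin (skew X)))) + strace (fun X => anti (F (anti
      (skew X)))).
Proof.
move=> lF.
have lp (P : 'M[R]_k -> 'M[R]_k) : linear P -> (forall x, P (P x) = P x) ->
   (forall x, P (skew x) = skew (P x)) ->
   strace (fun X => P (F (P (skew X)))) = strace (fun X => F (P (skew X))).
  move=> hP PP PS.
  have lG : linear (fun X => F (P (skew X))) by move=> c x y; rewrite
    skew_linear hP lF.
  rewrite (straceC hP lG); apply: eq_strace => X.
  by rewrite -PS PP.
rewrite (lp _ (jlin_linear _) jlin_idem jlin_skewC) (lp _ (janti_linear _)
  janti_idem janti_skewC).
rewrite -straceD; apply: eq_strace => X.
by rewrite -{1}(jlin_janti J (skew X)) -[lin _]scale1r lF !scale1r.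
Qed.

Lemma strace_udrift_anti z y : z^T = - z -> y^T = - y -> J *m z = - (z *m J) ->
  strace (fun X => lie (lie (drift (skew X)) z) y) =
  ((1 - u1 / (2 * u3)) * ((k%:R - 2) / 2) + (u1 - u0) / (2 * u3) * (4 / k%:R))
   * \tr (z *m y).
Proof.
move=> hz hy cz.
have e X : lie (lie (drift (skew X)) z) y =
   (1 - u1 / (2 * u3)) *: lie (lie (lin (skew X)) z) y
   + ((u1 - u0) / (2 * u3)) *: lie (lie (cen (skew X)) z) y.
  rewrite udriftE uscaleE; move: (lin _) (cen _) => s t.
  rewrite lie_lieD lie_lieN lie_lieZ (lie_lieD (u1 *: s)) (lie_lieZ u1)
    (lie_lieZ (_ - _)).
  by move: (lie _ _) (lie _ _) => v w; mxlin; field.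
rewrite (eq_strace e) straceD !straceZ strace_jlin_ad_anti //
  strace_jcenter_ad_anti //.
by ring.
Qed.

(** A path of two steps contributes if it returns to the summand it started
    from: u(p) to u(p) to u(p) gives the first term, m3 to m3 to m3 the last,
    and the paths u(p) to m3 to u(p) and m3 to u(p) to m3, equal by cyclicity,
    add up to the middle one. *)
Lemma strace_so_conn_so_conn z y : z^T = - z -> y^T = - y ->
  strace (fun X => nab (nab (skew X) z) y) =
  4^-1 * (k%:R / 2 * \tr (lin z *m lin y) + 2^-1 * (\tr (z *m J) * \tr (y *m
    J)))
  + ((1 - u1 / (2 * u3)) * ((k%:R - 2) / 2) + (u1 - u0) / (2 * u3) * (4 / k%:R))
   * \tr (anti z *m anti y)
  + (2 * u3)^-2 * (2^-1 * ((k%:R - 4) * \tr (lamu z *m lamu y)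
      - \tr (lamu z *m J) * \tr (lamu y *m J))).
Proof.
move=> hz hy.
rewrite (@strace_blocks (fun a => nab (nab a z) y)); last first.
  by move=> c a b; rewrite !so_conn_linearl.
have e1 X : lin (nab (nab (lin (skew X)) z) y) =
   4^-1 *: lie (lie (lin (skew X)) (lin z)) (lin y)
   + 2^-1 *: lie (lie (drift (skew X)) (anti z)) (anti y).
  rewrite jlin_so_conn // jlin_so_conn // janti_so_conn // jlin_idem
    janti_jlin0 -udrift_jlin.
  rewrite /lie !mul0mx !mulmx0 !subrr !scaler0 addr0 add0r.
  rewrite ?(mulmxDl, mulmxDr, mulNmx, mulmxN, =^~ scalemxAl, =^~ scalemxAr).
  by mxlin; field.
have e2 X : anti (nab (nab (anti (skew X)) z) y) =
   (2 * u3)^-2 *: lie (lie (anti (skew X)) (lamu z)) (lamu y)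
   + 2^-1 *: lie (drift (lie (anti (skew X)) (anti z))) (anti y).
  have lie0 (w : 'M[R]_k) : lie 0 w = 0 by rewrite /lie mul0mx mulmx0 subrr.
  have E1 : anti (nab (anti (skew X)) z) = (2 * u3)^-1 *: lie (anti (skew X))
    (lamu z).
    by rewrite janti_so_conn // janti_idem (udrift_jlin (anti _)) jlin_janti0
      udrift0 lie0 addr0.
  have E2 : drift (nab (anti (skew X)) z) = 2^-1 *: drift (lie (anti (skew X))
    (anti z)).
    rewrite (udrift_jlin (nab _ _)) jlin_so_conn // jlin_janti0 janti_idem lie0
      add0r.
    by rewrite -[_ *: lie _ _]addr0 udrift_linear udrift0 addr0.
  rewrite janti_so_conn // E1 E2 lieZl (lieZl 2^-1) scalerA; congr (_ *: _ + _).
  by rewrite -invfM -expr2.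
rewrite (eq_strace e1) (eq_strace e2) !straceD !straceZ.
have -> : strace (fun X => lie (drift (lie (anti (skew X)) (anti z))) (anti y))
  =
  strace (fun X => lie (lie (drift (skew X)) (anti y)) (anti z)).
  pose F1 X := lie (anti (skew X)) (anti z); pose G1 W := lie (drift (skew W))
    (anti y).
  have lF : linear F1 by move=> c a b; rewrite /F1 skew_linear janti_linear
    lie_linearl.
  have lG : linear G1 by move=> c a b; rewrite /G1 skew_linear udrift_linear
    lie_linearl.
  transitivity (strace (fun X => G1 (F1 X))).
    apply: eq_strace => X; rewrite /G1 /F1 [skew (lie _ _)]skew_id //.
    by rewrite lie_skew ?janti_skew ?skewT.
  rewrite (straceC lG lF); apply: eq_strace => X; rewrite /F1.
  rewrite (skew_id (a := G1 X)); last by rewrite lie_skew ?udrift_skew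
    ?janti_skew ?skewT.
  rewrite anti_janti //; apply: lie_ca; [exact: udrift_comm|exact: janti_anti].
rewrite strace_jlin_ad_comm ?jlin_skew // ?jlin_comm //.
rewrite strace_udrift_anti ?janti_skew // ?janti_anti // strace_udrift_anti
  ?janti_skew // ?janti_anti //.
rewrite strace_janti_ad_comm ?uscale_skew // ?uscale_comm //.
have trp x : \tr (lin x *m J) = \tr (x *m J).
  by rewrite -{2}(jlin_janti J x) mulmxDl mxtraceD (anti_trJ (janti_anti hJJ
    x)) addr0.
rewrite !trp (mxtrace_mulC (anti y)).
by field; rewrite hu3 pnatr_eq0 -lt0n hk.
Qed.

(** The isotropy term only sees the m2 parts, because so(q) acts trivially on
    so(k). *)
Lemma trace_ric_h y z (b c : 'M[R]_(k, q)) : y^T = - y -> z^T = - z ->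
  trace_on (mm R k q) (fun X => lie (pr_h R k q (lie X (emb y b))) (emb z c)) =
  (1 - q%:R) * \tr (b^T *m c).
Proof.
move=> hy hz.
have hc x : (b^T *m x - x^T *m b)^T = - (b^T *m x - x^T *m b).
  by rewrite trmxD trmxN !trmx_mul !trmxK opprB.
rewrite trace_on_mm //; last first.
- move=> X /(mmP hkq)[a [x [ha ->]]]; rewrite pr_h_lie // lie_dr_emb //.
  by rewrite emb_mm // linear0 oppr0.
- by move=> r X X'; rewrite lie_linearl linearP lie_linearl.
rewrite (eq_strace (G := fun a => 0 *: a)); last first.
  move=> a; rewrite pr_h_lie ?skewT // lie_dr_emb //.
  by rewrite ulsub_emb scale0r.
rewrite (eq_strace (G := fun x => - (c *m b^T *m x) + c *m x^T *m b)); last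
  first.
  move=> x; rewrite pr_h_lie ?linear0 ?oppr0 // lie_dr_emb // ursub_emb.
  by rewrite mulmxBr opprB addrC !mulmxA.
rewrite straceZ straceD straceN strace_mull strace_mul_tr.
by rewrite mxtrace_mulC (mxtrace_trC c); ring.
Qed.

Lemma Ric_conn y z (b c : 'M[R]_(k, q)) : y^T = - y -> z^T = - z ->
  Ric conn (emb y b) (emb z c) =
   - strace (fun X => nab (nab (skew X) z) y)
   - q%:R / 4 * \tr (lam y *m lam z)
   + (q%:R - 1 - mixed_coef) * \tr (b^T *m c).
Proof.
move=> hy hz.
rewrite (@Ric_trace conn) ?emb_mm //; last first.
- exact: trace_conn.
- exact: conn_torsion.
- by move=> X Y hX hY; apply: conn_mm.
- exact: conn_linearl.
rewrite trace_ric_h // trace_on_mm //; last first.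
- by move=> X hX; rewrite !conn_mm // emb_mm.
- by move=> r X X'; rewrite !conn_linearl.
rewrite (eq_strace (G := fun a => nab (nab (skew a) z) y +
   (let d := skew a *m c - 2^-1 *: (lam (skew a) *m c) in
     2^-1 *: (b *m d^T - d *m b^T)))); last first.
  by move=> a; rewrite conn_emb_so conn_emb ulsub_emb.
rewrite straceD strace_mixed_so.
rewrite (eq_strace (G := fun x => (let w := 2^-1 *: (c *m x^T - x *m c^T) in
     (w - 2^-1 *: lam w) *m b) + 4^-1 *: (lam y *m lam z *m x))); last first.
  move=> x; rewrite conn_emb_m2 conn_emb ursub_emb /= [in RHS]mulmxBl
    -(scalemxAl _ (lam _)).
  move: (2^-1 *: _) => w; rewrite -scalemxAr mulmxA scalerDr scalerA opprD
    addrA.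
  congr (_ + _); rewrite -scaleNr; congr (_ *: _); lra.
rewrite straceD strace_mixed straceZ strace_mull (mxtrace_trC c).
by field.
Qed.
End Ricci.

(** * The Einstein equations *)

(** The equation Ric = c g on m0, m1, m3 and m2, in this order, for k = 2p and
    u2 = 1; mu stands for c (n - 2). *)
Definition einstein_system (R : realType) (p q : nat) (u0 u1 u3 mu : R) : Prop
  :=
  [/\ mu * u0 = (p%:R - 1) * u0 ^+ 2 / (2 * u3 ^+ 2) + q%:R * u0 ^+ 2 / 4,
      mu * u1 = p%:R / 4 + (p%:R - 2) * u1 ^+ 2 / (4 * u3 ^+ 2) + q%:R * u1 ^+
        2 / 4,
      mu * u3 = p%:R - 1 - (2 * u0 / p%:R + u1 * (p%:R ^+ 2 - p%:R - 2) / p%:R)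
        / (2 * u3)
                + q%:R * u3 ^+ 2 / 4
    & 2 * mu = (p + p + q)%:R - 2
        - (u0 / p%:R + u1 * (p%:R ^+ 2 - 1) / p%:R + u3 * (p%:R - 1)) / 2].

Section Einstein.
Variables (R : realType) (k q : nat).
Hypotheses (hk : (0 < k)%N) (hkq : (2 < k + q)%N).
Variable J : 'M[R]_k.
Hypotheses (hJT : J^T = - J) (hJJ : J *m J = - 1%:M).
Variables u0 u1 u3 : R.
Local Notation lin := (jlin J).
Local Notation anti := (janti J).
Local Notation cen := (jcenter J).
Local Notation lamu := (uscale J u0 u1).
Local Notation lam := (soscale J u0 u1 u3).
Local Notation metric := (@stiefel_metric R k q J u0 u1 u3).

Lemma tr_jlin_J x : \tr (lin x *m J) = \tr (x *m J).
Proof.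
by rewrite -[in RHS](jlin_janti J x) mulmxDl mxtraceD (anti_trJ (janti_anti hJJ
  x)) addr0.
Qed.

Lemma tr_uscale_J x : \tr (lamu x *m J) = u0 * \tr (x *m J).
Proof.
have k0 : k%:R != 0 :> R by rewrite pnatr_eq0 -lt0n.
rewrite uscaleE mulmxDl -!scalemxAl mxtraceD !mxtraceZ tr_jlin_J tr_jcenter hJJ.
by rewrite mxtraceN mxtrace1; field.
Qed.

Lemma tr_uscale_uscale x y : \tr (lamu x *m lamu y) =
  u1 ^+ 2 * \tr (lin x *m lin y)
  - (u0 ^+ 2 - u1 ^+ 2) / k%:R * (\tr (x *m J) * \tr (y *m J)).
Proof.
rewrite uscaleE !(mulmxDl, mulmxDr) -!scalemxAl -!scalemxAr; trexpand.
rewrite (mxtrace_mulC (cen x) (lin y)) !tr_jcenter_jcenter // !tr_jlin_jcenter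
  //.
by ring.
Qed.

Lemma tr_soscale_soscale x y : \tr (lam x *m lam y) =
  \tr (lamu x *m lamu y) + u3 ^+ 2 * \tr (anti x *m anti y).
Proof.
have cp z : lin (lamu z) = lamu z by exact: comm_jlin (uscale_comm hJJ _ _ z).
rewrite soscaleE !(mulmxDl, mulmxDr) -!scalemxAl -!scalemxAr; trexpand.
rewrite (mxtrace_mulC (anti x) (lamu y)) -(cp x) -(cp y) !tr_jlin_janti //.
by ring.
Qed.

Lemma tr_soscale_expand x y : \tr (lam x *m y) =
  u1 * \tr (lin x *m lin y) - (u0 - u1) / k%:R * (\tr (x *m J) * \tr (y *m J))
  + u3 * \tr (anti x *m anti y).
Proof.
rewrite (tr_soscale hJJ) uscaleE mulmxDr -!scalemxAr; trexpand.
by rewrite tr_jlin_jcenter //; ring.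
Qed.
End Einstein.

Section Einstein2.
Variables (R : realType) (p q : nat).
Hypotheses (hp : (0 < p)%N) (hkq : (2 < p + p + q)%N).
Variable J : 'M[R]_(p + p).
Hypotheses (hJT : J^T = - J) (hJJ : J *m J = - 1%:M).
Variables u0 u1 u3 mu : R.
Hypotheses (hu0 : 0 < u0) (hu1 : 0 < u1) (hu3 : 0 < u3).

(** Both Ric and the metric are combinations of the four forms tr(b^T c),
    tr(y+ z+), tr(y J) tr(z J) and tr(y- z-), where + and - denote the
    components in u(p) and m3. Comparing coefficients gives the system; the
    one of tr(y J) tr(z J) is the difference of the equations for m0 and m1.
    *)
Lemma metric_einstein : einstein_system p q u0 u1 u3 mu ->
  einstein (stiefel_metric (q := q) J u0 u1 u3).
Proof.
case=> m0 m1 m3 m2.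
have hk : (0 < p + p)%N by rewrite addn_gt0 hp.
have n3 : u3 != 0 by rewrite gt_eqF.
split; first exact: metric_invariant_metric.
exists (stiefel_conn J u0 u1 u3), (mu / ((p + p + q)%:R - 2)); split.
  exact: conn_levi_civita.
move=> X Y /(mmP hkq)[y [b [hy ->]]] /(mmP hkq)[z [c [hz ->]]].
have np : p%:R != 0 :> R by rewrite pnatr_eq0 -lt0n.
have d0 := lt0r_neq0 (dim_gt2 R hkq).
rewrite Ric_conn // metric_emb strace_so_conn_so_conn // tr_soscale_soscale //
  tr_soscale_expand //.
rewrite !tr_uscale_J // !tr_uscale_uscale // /mixed_coef.
rewrite (mxtrace_mulC (jlin J z)) (mxtrace_mulC (janti J z)).
move: (\tr (jlin J y *m jlin J z)) (\tr (janti J y *m janti J z)).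
move: (\tr (z *m J)) (\tr (y *m J)) (\tr (b^T *m c)).
move=> sz sy t P M.
have -> : mu / ((p + p + q)%:R - 2) * (((p + p + q)%:R - 2) * (2 * t -
   (u1 * P - (u0 - u1) / (p + p)%:R * (sy * sz) + u3 * M))) =
   (2 * mu) * t - (mu * u1) * P + ((mu * u0) - (mu * u1)) / (p + p)%:R * (sy *
     sz)
   - (mu * u3) * M.
  by rewrite [LHS]mulrA divfK //; ring.
rewrite m0 m1 m2 m3 !natrD.
by field; rewrite n3 np -natrD pnatr_eq0 -lt0n hk.
Qed.
End Einstein2.

(** * The unitary group *)

Section Unitary.
Variables (R : realType) (p : nat).

(** Multiplication by i on C^p, in the coordinates used by [realify]. *)
Definition stdJ : 'M[R]_(p + p) := block_mx 0 (- 1%:M) 1%:M 0.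

Lemma stdJT : stdJ^T = - stdJ.
Proof.
by rewrite /stdJ tr_block_mx opp_block_mx !trmx0 trmxN !trmx1 oppr0 opprK.
Qed.

Lemma stdJJ : stdJ *m stdJ = - 1%:M.
Proof.
rewrite /stdJ mulmx_block !(mul0mx, mulmx0, mulmxN, mulNmx, add0r, addr0,
  mulmx1).
by rewrite (@scalar_mx_block _ p p) opp_block_mx !oppr0.
Qed.

Lemma realify_J (M : 'M[R[i]]_p) : stdJ *m realify M = realify M *m stdJ.
Proof.
rewrite /stdJ /realify !mulmx_block.
by rewrite !(mul0mx, mulmx0, mulmxN, mulNmx, add0r, addr0, mulmx1, mul1mx,
  opprK).
Qed.

Lemma ReD (x y : R[i]) : complex.Re (x + y) = complex.Re x + complex.Re y.
Proof. by case: x y => a b [c d]. Qed.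
Lemma ImD (x y : R[i]) : complex.Im (x + y) = complex.Im x + complex.Im y.
Proof. by case: x y => a b [c d]. Qed.

(** The real and imaginary parts of M M^* = 1 are the blocks of the
    orthogonality relation. *)
Lemma unitary_realify (M : 'M[R[i]]_p) : M \is unitarymx ->
  (realify M)^T *m realify M = 1%:M.
Proof.
move=> /unitarymxP hM; apply: mulmx1C.
set X := map_mx (@complex.Re R) M; set Y := map_mx (@complex.Im R) M.
have [e1 e2] : X *m X^T + Y *m Y^T = 1%:M /\ Y *m X^T - X *m Y^T = 0.
  split; apply/matrixP => i j; have := congr1 (fun A : 'M_p => A i j) hM.
    move/(congr1 (@complex.Re R)); rewrite !mxE (big_morph _ ReD (erefl _)) =>
      e.
    transitivity (complex.Re ((i == j)%:R : R[i])); last by case: (i == j).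
    rewrite -e -big_split; apply: eq_bigr => l _ /=.
    by rewrite !mxE; case: (M i l) => a b; case: (M j l) => c d /=; ring.
  move/(congr1 (@complex.Im R)); rewrite !mxE (big_morph _ ImD (erefl _)) => e.
  transitivity (complex.Im ((i == j)%:R : R[i])); last by case: (i == j).
  rewrite -e -sumrN -big_split; apply: eq_bigr => l _ /=.
  by rewrite !mxE; case: (M i l) => a b; case: (M j l) => c d /=; ring.
rewrite /realify -/X -/Y tr_block_mx mulmx_block !trmxN.
rewrite !(mulmxN, mulNmx, opprK) e1 (addrC (Y *m Y^T)) e1 e2.
by rewrite -[X *m _ - _]opprB e2 oppr0 -scalar_mx_block.
Qed.
End Unitary.

(** * Solutions of the Einstein equations *)

Section Solutions.
Variables (R : realType) (p q : nat).
Hypotheses (hp : (2 <= p)%N) (hpq : (p + 5 <= 2 * q)%N).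
Local Notation P := (p%:R : R).
Local Notation Q := (q%:R : R).

Lemma p_ge2 : 2 <= P. Proof. by rewrite ler_nat. Qed.
Lemma q_ge : P + 5 <= 2 * Q.
Proof. by rewrite -!natrM -natrD ler_nat. Qed.

(** With all three scales equal to x the first three equations coincide and
    define mu; the last becomes this quadratic equation. *)
Lemma jensen_solution (x : R) : 0 < x ->
  (2 * P + Q - 1) * x ^+ 2 - 2 * (2 * P + Q - 2) * x + 2 * (P - 1) = 0 ->
  einstein_system p q x x x ((P - 1) / (2 * x) + Q * x / 4).
Proof.
move=> x0 e; have pge2 := p_ge2.
have [nx np] : x != 0 /\ P != 0 by split; apply: lt0r_neq0; lra.
rewrite /einstein_system !natrD; split; try by field; rewrite ?nx ?np.
apply/eqP; rewrite -subr_eq0; apply/eqP.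
transitivity (((2 * P + Q - 1) * x ^+ 2 - 2 * (2 * P + Q - 2) * x + 2 * (P -
  1)) / (2 * x)).
  by field; rewrite nx np.
by rewrite e mul0r.
Qed.

Lemma jensen_roots : exists x y : R, [/\ 0 < x, 0 < y, x != y &
  forall z, z = x \/ z = y ->
  (2 * P + Q - 1) * z ^+ 2 - 2 * (2 * P + Q - 2) * z + 2 * (P - 1) = 0].
Proof.
have pge2 := p_ge2; have q0 := q_ge.
pose d := Num.sqrt ((Q - 1) ^+ 2 + 2 * P * (Q - 1) + 1).
have dpos : 0 < (Q - 1) ^+ 2 + 2 * P * (Q - 1) + 1 by nra.
have d2 : d ^+ 2 = (Q - 1) ^+ 2 + 2 * P * (Q - 1) + 1 by rewrite sqr_sqrtr //
  ltW.
have d0 : 0 < d by rewrite sqrtr_gt0.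
have dlt : d < 2 * P + Q - 2 by nra.
have n0 : 0 < 2 * P + Q - 1 by lra.
exists ((2 * P + Q - 2 + d) / (2 * P + Q - 1)), ((2 * P + Q - 2 - d) / (2 * P +
  Q - 1)).
split.
- by apply: divr_gt0; lra.
- by apply: divr_gt0; lra.
- apply/eqP => /(congr1 ( *%R^~ (2 * P + Q - 1))); rewrite !divfK ?gt_eqF // =>
  h; lra.
have nn := lt0r_neq0 n0.
move=> z [] ->.
  transitivity ((d ^+ 2 - ((Q - 1) ^+ 2 + 2 * P * (Q - 1) + 1)) / (2 * P + Q -
    1)).
    by field.
  by rewrite d2 subrr mul0r.
transitivity ((d ^+ 2 - ((Q - 1) ^+ 2 + 2 * P * (Q - 1) + 1)) / (2 * P + Q -
  1)).
  by field.
by rewrite d2 subrr mul0r.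
Qed.

(** Write u3 = z, u1 = r z, u0 = v z and s = q z^2. The equation for m1
    defines mu and the one for m0 then defines v. Multiplied by 4 p r (2p - 2
    + s), the one for m3 is divisible by r - 1, the factor of Jensen's
    metrics, and the cofactor is linear in r: its root is r = [curveN s /
    curveD s]. *)
Definition curveN (s : R) := 2 * P ^+ 2 - 2 * P + 4 + P * s.
Definition curveD (s : R) := s ^+ 2 + (5 * P - 6) * s + 2 * (P - 2) * (3 * P -
  1).
Definition curveT (s : R) := 2 * P - 2 + s.
Definition ratio1 s := curveN s / curveD s.
Definition ratio0 s := (P / ratio1 s + ratio1 s * (P - 2 + s)) / curveT s.
(** What is left of the system: 2 z times the equation for m2. *)
Definition residual (z : R) := let s := Q * z ^+ 2 in
  P / ratio1 s + ratio1 s * (P - 2 + s)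
  + z ^+ 2 * (ratio0 s / P + ratio1 s * (P ^+ 2 - 1) / P + P - 1)
  - 2 * (2 * P + Q - 2) * z.

Lemma curveN_gt0 s : 0 < s -> 0 < curveN s.
Proof. by move=> s0; have pge2 := p_ge2; rewrite /curveN; nra. Qed.
Lemma curveD_gt0 s : 0 < s -> 0 < curveD s.
Proof. by move=> s0; have pge2 := p_ge2; rewrite /curveD; nra. Qed.
Lemma curveT_gt0 s : 0 < s -> 0 < curveT s.
Proof. by move=> s0; have pge2 := p_ge2; rewrite /curveT; lra. Qed.
Lemma ratio1_gt0 s : 0 < s -> 0 < ratio1 s.
Proof. by move=> s0; rewrite divr_gt0 ?curveN_gt0 ?curveD_gt0. Qed.
Lemma curve_shift_gt0 s :
  0 < s -> 0 < P - 2 + s.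
Proof. have := p_ge2; lra. Qed.
Lemma curve_sum_gt0 s : 0 < s -> 0 < P / ratio1 s + ratio1 s * (P - 2 + s).
Proof.
move=> s0; have r0 := ratio1_gt0 s0; have pge2 := p_ge2.
by apply: addr_gt0; [apply: divr_gt0; lra | apply: mulr_gt0; rewrite
  ?curve_shift_gt0].
Qed.
Lemma ratio0_gt0 s : 0 < s -> 0 < ratio0 s.
Proof. by move=> s0; rewrite divr_gt0 ?curveT_gt0 ?curve_sum_gt0. Qed.
Lemma qsq_gt0 z : 0 < z -> 0 < Q * z ^+ 2.
Proof.
by move=> z0; apply: mulr_gt0; [have := p_ge2; have := q_ge; lra|apply:
  exprn_gt0].
Qed.

Lemma residual_solution z : 0 < z -> residual z = 0 ->
  let s := Q * z ^+ 2 in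
  einstein_system p q (ratio0 s * z) (ratio1 s * z) z
    ((P / ratio1 s + ratio1 s * (P - 2 + s)) / (4 * z)).
Proof.
move=> z0 e s.
have s0 : 0 < s := qsq_gt0 z0.
have pge2 := p_ge2; have nz := lt0r_neq0 z0.
have np : P != 0 by apply: lt0r_neq0; lra.
have nN := lt0r_neq0 (curveN_gt0 s0); have nD := lt0r_neq0 (curveD_gt0 s0).
have nT := lt0r_neq0 (curveT_gt0 s0); have nr := lt0r_neq0 (ratio1_gt0 s0).
have ev : P / ratio1 s + ratio1 s * (P - 2 + s) = ratio0 s * curveT s.
  by rewrite /ratio0 divfK.
have eQ : Q = s / z ^+ 2 by rewrite /s mulfK // expf_neq0.
split.
- by rewrite ev /curveT eQ; field; rewrite nz.
- by rewrite eQ; field; rewrite nz nr.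
- rewrite eQ; move: nN nD nT; rewrite /ratio0 /ratio1 /curveN /curveD /curveT
  => nN nD nT.
  by field; rewrite nz nN nD nT np.
move: e; rewrite /residual -/s !natrD => e.
apply/eqP; rewrite -subr_eq0; apply/eqP.
rewrite -[RHS](mul0r (2 * z)^-1) -e; move: (ratio0 s) (ratio1 s) nr => v r nr.
by field; rewrite nz nr np.
Qed.
(** A common denominator, positive for s > 0, which turns [residual] into a
    polynomial. *)
Definition clearing (s : R) := curveN s * curveD s * curveT s * P.

Lemma clearing_gt0 s : 0 < s -> 0 < clearing s.
Proof.
move=> s0; rewrite /clearing !mulr_gt0 ?curveN_gt0 ?curveD_gt0 ?curveT_gt0 //.
by have := p_ge2; lra.
Qed.

Lemma residual_poly : exists f : {poly R}, forall z, 0 < z ->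
  f.[z] = residual z * clearing (Q * z ^+ 2).
Proof.
have [S eS] : exists S : {poly R}, forall z, S.[z] = Q * z ^+ 2.
  by exists (Q%:P * 'X^2) => z; rewrite hornerM hornerC hornerXn.
have [N eN] : exists N : {poly R}, forall z, N.[z] = curveN (Q * z ^+ 2).
  exists ((2 * P ^+ 2 - 2 * P + 4)%:P + P%:P * S) => z.
  by rewrite hornerD hornerM !hornerC eS.
have [D eD] : exists D : {poly R}, forall z, D.[z] = curveD (Q * z ^+ 2).
  exists (S * S + (5 * P - 6)%:P * S + (2 * (P - 2) * (3 * P - 1))%:P) => z.
  by rewrite !hornerD !hornerM !hornerC eS.
have [T eT] : exists T : {poly R}, forall z, T.[z] = curveT (Q * z ^+ 2).
  by exists ((2 * P - 2)%:P + S) => z; rewrite hornerD hornerC eS.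
have [W eW] : exists W : {poly R}, forall z, W.[z] =
    P * curveD (Q * z ^+ 2) ^+ 2 + curveN (Q * z ^+ 2) ^+ 2 * (P - 2 + Q * z ^+
      2).
  exists (P%:P * (D * D) + (N * N) * ((P - 2)%:P + S)) => z.
  by rewrite !(hornerD, hornerM, hornerC) eD eN eS.
exists (W * T * P%:P
   + 'X * 'X * (W + (P ^+ 2 - 1)%:P * N * N * T + ((P - 1) * P)%:P * N * D * T)
   - (2 * (2 * P + Q - 2))%:P * 'X * N * D * T * P%:P) => z z0.
have pge2 := p_ge2; have s0 := qsq_gt0 z0.
have np : P != 0 by apply: lt0r_neq0; lra.
have := lt0r_neq0 (curveN_gt0 s0); have := lt0r_neq0 (curveD_gt0 s0).
have := lt0r_neq0 (curveT_gt0 s0).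
rewrite !(hornerD, hornerN, hornerM, hornerC, hornerX) eN eD eT eW.
rewrite /residual /clearing /ratio0 /ratio1.
move: (curveN _) (curveD _) (curveT _) => n d t nt nd nn.
by field; rewrite nt nd nn np.
Qed.

(** By the arithmetic-geometric inequality p / r + r (p - 2 + s) >= 2 sqrt(p
    (p - 2)) >= 2 when p > 2, and for p = 2 it equals s + 2. This balances the
    negative term, which is -2 at z = 1 / (n - 2). *)
Lemma residual_start : 0 < residual (2 * P + Q - 2)^-1.
Proof.
have pge2 := p_ge2; have q0 := q_ge.
set z := _^-1; have z0 : 0 < z by rewrite invr_gt0; lra.
have s0 := qsq_gt0 z0; rewrite /residual; set s := Q * z ^+ 2 in s0 *.
have r0 := ratio1_gt0 s0; have v0 := ratio0_gt0 s0.
have N0 := curveN_gt0 s0; have D0 := curveD_gt0 s0.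
have -> : 2 * (2 * P + Q - 2) * z = 2 by rewrite -mulrA mulfV ?mulr1 //
  lt0r_neq0 //; lra.
have hz : 0 < z ^+ 2 * (ratio0 s / P + ratio1 s * (P ^+ 2 - 1) / P + P - 1).
  apply: mulr_gt0; first exact: exprn_gt0.
  have h1 : 0 < ratio0 s / P by apply: divr_gt0 => //; lra.
  have h2 : 0 < ratio1 s * (P ^+ 2 - 1) / P.
    by apply: divr_gt0; [apply: mulr_gt0 => //; nra|lra].
  lra.
suff h : 2 <= P / ratio1 s + ratio1 s * (P - 2 + s) by lra.
have nN := lt0r_neq0 N0; have nD := lt0r_neq0 D0.
have -> : P / ratio1 s + ratio1 s * (P - 2 + s) =
  (P * curveD s ^+ 2 + curveN s ^+ 2 * (P - 2 + s)) / (curveN s * curveD s).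
  by rewrite /ratio1; field; rewrite nN nD.
rewrite ler_pdivlMr ?mulr_gt0 //.
have [p3|p2] := leqP 3 p; last first.
  have e : P = 2 by congr (_%:R); apply/eqP; rewrite eqn_leq hp -ltnS p2.
  by rewrite /curveN /curveD e; nra.
have p3' : 3 <= P by rewrite ler_nat.
have : 0 <= (curveD s - curveN s) ^+ 2 by apply: sqr_ge0.
have : 0 <= curveN s ^+ 2 * (P - 3 + s) by apply: mulr_ge0; [apply:
  sqr_ge0|lra].
have : 0 <= curveD s ^+ 2 * (P - 1) by apply: mulr_ge0; [apply: sqr_ge0|lra].
nra.
Qed.

(** At z = 2 (n - 2) the negative term is -z^2, and z^2 (p - 1) compensates
    it. *)
Lemma residual_end : 0 < residual (2 * (2 * P + Q - 2)).
Proof.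
have pge2 := p_ge2; have q0 := q_ge.
set z := 2 * _; have z0 : 0 < z by rewrite /z; lra.
have s0 := qsq_gt0 z0; rewrite /residual; set s := Q * z ^+ 2 in s0 *.
have r0 := ratio1_gt0 s0; have v0 := ratio0_gt0 s0; have g0 := curve_sum_gt0 s0.
have h1 : 0 < ratio0 s / P by apply: divr_gt0 => //; lra.
have h2 : 0 < ratio1 s * (P ^+ 2 - 1) / P.
  by apply: divr_gt0; [apply: mulr_gt0 => //; nra|lra].
rewrite -/z; have : 0 <= z * z * (ratio0 s / P + ratio1 s * (P ^+ 2 - 1) / P +
  P - 2).
  by rewrite !mulr_ge0 //; lra.
nra.
Qed.

(** The point z^2 = p / q, that is s = p, makes r tend to 1/4 as p grows and [residual]
    negative. The hypothesis p <= 2n/5 - 1, in the form 2q >= p + 5, is nearly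
    sharp for this: as p grows with q about p / 2, the two sides of the
    inequality [key] have ratio about 0.98. *)
Lemma residual_mid : residual (Num.sqrt (P / Q)) < 0.
Proof.
have pge2 := p_ge2; have q0 := q_ge.
have Q0 : 0 < Q by lra.
set z := Num.sqrt _.
have z0 : 0 < z by rewrite sqrtr_gt0 divr_gt0 //; lra.
have z2 : z ^+ 2 = P / Q by rewrite sqr_sqrtr // divr_ge0 //; lra.
have s0 := qsq_gt0 z0; rewrite /residual.
have -> : Q * z ^+ 2 = P by rewrite z2 mulrC divfK // gt_eqF.
have P0 : 0 < P by lra.
have N0 := curveN_gt0 P0; have D0 := curveD_gt0 P0; have T0 := curveT_gt0 P0.
have nN := lt0r_neq0 N0; have nD := lt0r_neq0 D0.
set A := P / _ + _.
(* As p grows r tends to 1/4, so A is about 4p + p/2 and p B about p^2 +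
   p^2/4; the constants -4 and 3/4 make the bounds valid from p = 2 on. *)
have hA : A <= 9 / 2 * P - 4.
  have -> : A = (P * curveD P ^+ 2 + curveN P ^+ 2 * (P - 2 + P)) / (curveN P *
    curveD P).
    by rewrite /A /ratio1; field; rewrite nN nD.
  rewrite ler_pdivrMr ?mulr_gt0 // /curveN /curveD.
  have [m0 m1] : exists m, 0 <= m /\ P = m + 2 by exists (P - 2); split; lra.
  move: m1 => [m2 ->]; nra.
have hv : ratio0 P <= 3 / 2.
  rewrite /ratio0 -/A ler_pdivrMr // /curveT; lra.
have hr : ratio1 P * (P ^+ 2 - 1) <= P ^+ 2 / 4 + 7 / 4 * P - 3 / 2.
  rewrite /ratio1 mulrAC ler_pdivrMr // /curveN /curveD.
  have [m0 [m1 ->]] : exists m, 0 <= m /\ P = m + 2 by exists (P - 2); split;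
    lra.
  nra.
set B := ratio0 P / P + _ + P - 1.
have hB : P * B <= 5 / 4 * P ^+ 2 + 3 / 4 * P.
  have -> : P * B = ratio0 P + ratio1 P * (P ^+ 2 - 1) + P ^+ 2 - P.
    by rewrite /B; field; rewrite lt0r_neq0.
  lra.
(* The square of A q + p B < 2 (n - 2) sqrt(p q), with A and p B replaced by
   their bounds. *)
have key : ((9 / 2 * P - 4) * Q + 5 / 4 * P ^+ 2 + 3 / 4 * P) ^+ 2 <
   4 * P * Q * (2 * P + Q - 2) ^+ 2.
  have [m [m0 em]] : exists m, 0 <= m /\ P = m + 2 by exists (P - 2); split;
    lra.
  have [w [w0 ew]] : exists w, 0 <= w /\ Q = (P + 5 + w) / 2.
    by exists (2 * Q - P - 5); split; lra.
  rewrite ew em -subr_gt0; set lhs := (X in 0 < X).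
  (* In terms of m = p - 2 and w = 2q - p - 5 nearly all coefficients are
     nonnegative; (m - 5)^2 (m + 8) absorbs the others. *)
  have -> : lhs = 271 + m * ((m - 5) ^+ 2 * (m + 8) / 4 + m / 4 + 225 / 2)
      + w * (155 + 223 / 2 * m + 21 / 2 * m ^+ 2 + 7 / 4 * m ^+ 3)
      + w ^+ 2 * (91 / 4 + 57 / 4 * m + 7 / 16 * m ^+ 2) + w ^+ 3 * (1 + m / 2).
    by rewrite /lhs; field.
  have sq := sqr_ge0 (m - 5).
  have m2 := exprn_ge0 2 m0; have m3 := exprn_ge0 3 m0.
  have : 0 <= m * ((m - 5) ^+ 2 * (m + 8) / 4 + m / 4 + 225 / 2).
    apply: mulr_ge0 => //.
    have : 0 <= (m - 5) ^+ 2 * (m + 8) by apply: mulr_ge0 => //; lra.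
    lra.
  have : 0 <= w * (155 + 223 / 2 * m + 21 / 2 * m ^+ 2 + 7 / 4 * m ^+ 3).
    by apply: mulr_ge0 => //; lra.
  have : 0 <= w ^+ 2 * (91 / 4 + 57 / 4 * m + 7 / 16 * m ^+ 2).
    by apply: mulr_ge0; [exact: exprn_ge0|lra].
  have : 0 <= w ^+ 3 * (1 + m / 2).
    by apply: mulr_ge0; [exact: exprn_ge0|lra].
  lra.
(* Multiplied by q, the claim reads A q + p B < 2 (n - 2) z q. *)
have zB : z ^+ 2 * B * Q = P * B by rewrite z2; field; rewrite lt0r_neq0.
rewrite -(pmulr_llt0 _ Q0) mulrBl mulrDl zB.
have : (9 / 2 * P - 4) * Q + 5 / 4 * P ^+ 2 + 3 / 4 * P < 2 * (2 * P + Q - 2) *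
  (z * Q).
  rewrite -(@ltr_pXn2r _ 2) // ?nnegrE.
  - apply: lt_le_trans key _; rewrite !exprMn z2.
    have -> : 2 ^+ 2 * (2 * P + Q - 2) ^+ 2 * (P / Q * Q ^+ 2) = 4 * P * Q * (2
      * P + Q - 2) ^+ 2.
      by field; rewrite lt0r_neq0.
    by [].
  - nra.
  - by rewrite !mulr_ge0 //; lra.
have : A * Q <= (9 / 2 * P - 4) * Q by rewrite ler_pM2r.
lra.
Qed.

(** The sign changes of [residual] at 1 / (n - 2), sqrt(p / q) and 2 (n - 2)
    give one root strictly on each side of sqrt(p / q). *)
Lemma other_solutions : exists x y : R, [/\ 0 < x, 0 < y, x != y &
  forall z, z = x \/ z = y -> residual z = 0 /\ Q * z ^+ 2 != P].
Proof.
have pge2 := p_ge2; have q0 := q_ge.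
have [f hf] := residual_poly.
set n2 := 2 * P + Q - 2.
have n0 : 0 < n2 by rewrite /n2; lra.
set m := Num.sqrt (P / Q).
have hPQ : 0 < P / Q by apply: divr_gt0; lra.
have m0 : 0 < m by rewrite sqrtr_gt0.
have m2 : m ^+ 2 = P / Q by rewrite sqr_sqrtr // ltW.
have lt1 : n2^-1 < m.
  rewrite -(@ltr_pXn2r _ 2) ?nnegrE ?invr_ge0 // ?ltW // m2.
  rewrite ltr_pdivlMr ?exprVn; last by lra.
  rewrite mulrC ltr_pdivrMr ?exprn_gt0 //.
  have n2Q : Q < n2 by rewrite /n2; lra.
  have : 0 <= n2 * (P * n2 - 1) by apply: mulr_ge0; nra.
  lra.
have lt2 : m < 2 * n2.
  rewrite -(@ltr_pXn2r _ 2) ?nnegrE // ?ltW //; last by lra.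
  rewrite m2 ltr_pdivrMr; last by lra.
  have n2P : P < n2 by rewrite /n2; lra.
  have : 0 <= n2 * (4 * n2 * Q - 1) by apply: mulr_ge0; nra.
  lra.
have fsign z : 0 < z -> 0 < residual z -> 0 < f.[z].
  by move=> z0 h; rewrite hf // mulr_gt0 // clearing_gt0 // qsq_gt0.
have fm : f.[m] < 0.
  by rewrite hf // pmulr_llt0 ?residual_mid // clearing_gt0 // qsq_gt0.
have f1 : 0 < f.[n2^-1] by apply: fsign; rewrite ?invr_gt0 // residual_start.
have f2 : 0 < f.[2 * n2] by apply: fsign; rewrite ?mulr_gt0 // residual_end.
have [|x] := @poly_ivtoo _ f _ _ (ltW lt1); first by rewrite pmulr_rlt0.
rewrite in_itv /= => /andP[x1 xm] rx.
have [|y] := @poly_ivtoo _ f _ _ (ltW lt2); first by rewrite nmulr_rlt0.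
rewrite in_itv /= => /andP[my y2] ry.
have x0 : 0 < x by apply: lt_trans x1; rewrite invr_gt0.
have y0 : 0 < y by apply: lt_trans my.
have rootE z : 0 < z -> root f z -> residual z = 0.
  move=> z0 /rootP; rewrite hf // => /eqP; rewrite mulf_eq0 => /orP[/eqP //|].
  by rewrite gt_eqF // clearing_gt0 // qsq_gt0.
have neq z : 0 < z -> Q * z ^+ 2 = P -> z = m.
  move=> z0 e; rewrite /m -e (mulrC Q) mulfK; last by rewrite gt_eqF //; lra.
  by rewrite sqrtr_sqr gtr0_norm.
exists x, y; split=> //; first by rewrite lt_eqF // (lt_trans xm).
move=> z [] ->; split; rewrite ?rootE //; apply/eqP => /neq.
  by move=> /(_ x0) e; rewrite e ltxx in xm.
by move=> /(_ y0) e; rewrite e ltxx in my.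
Qed.

(** The difference curveD - curveN is (s + 2p)(s + 2p - 6). Hence r = 1 at a
    positive s requires p = 2 and s = 2 = p, the point where [residual] is
    negative. *)
Lemma ratio1_neq1 s : 0 < s -> s != P -> ratio1 s != 1.
Proof.
move=> s0 nsP; have pge2 := p_ge2; have D0 := curveD_gt0 s0.
apply: contra nsP => /eqP r1.
have e : curveN s = curveD s.
  by rewrite -[RHS]mul1r -r1 /ratio1 divfK // gt_eqF.
apply/eqP.
have : (s + 2 * P) * (s + 2 * P - 6) = 0.
  by rewrite -[RHS](subrr (curveD s)) -{2}e /curveN /curveD; ring.
move/eqP; rewrite mulf_eq0 gt_eqF /=; last by lra.
move=> /eqP e2; have [p3|p2] := leqP 3 p.
  have p3' : 3 <= P by rewrite ler_nat.
  lra.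
have : P = 2 by congr (_%:R); apply/eqP; rewrite eqn_leq hp -ltnS p2.
lra.
Qed.
End Solutions.

(** * The four metrics *)

Section Separation.
Variables (R : realType) (p q : nat).
Hypotheses (hp : (2 <= p)%N) (hq : (0 < q)%N).
Local Notation J := (stdJ R p).
Local Notation met u0 u1 u3 := (stiefel_metric (q := q) J u0 u1 u3).

Lemma kq_gt2 : (2 < p + p + q)%N. Proof. lia. Qed.

Lemma soscale_su u0 u1 u3 (a : 'M[R]_(p + p)) :
  J *m a = a *m J -> \tr (a *m J) = 0 ->
  soscale J u0 u1 u3 a = u1 *: a.
Proof.
move=> h ht; rewrite soscaleE uscaleE jcenterE ht (comm_jlin (stdJJ R p) h)
  (comm_janti (stdJJ R p) h).
by rewrite mul0r oppr0 scale0r !scaler0 !addr0.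
Qed.

Lemma soscale_anti u0 u1 u3 (a : 'M[R]_(p + p)) : J *m a = - (a *m J) ->
  soscale J u0 u1 u3 a = u3 *: a.
Proof.
move=> h; rewrite soscaleE uscaleE (anti_jcenter h) (anti_jlin (stdJJ R p) h)
  (anti_janti (stdJJ R p) h).
by rewrite !scaler0 !add0r.
Qed.

(** An infinitesimal rotation, nonzero because p >= 2. It yields test vectors
    in su(p) and in m3. *)
Definition rot : 'M[R]_p :=
  let i := Ordinal (ltnW hp) in let j := Ordinal hp in delta_mx i j - delta_mx
    j i.

Lemma rotT : rot^T = - rot.
Proof. by rewrite /rot trmxD trmxN !trmx_delta opprB. Qed.

Lemma tr_rot : \tr (rot *m rot) < 0.
Proof.
rewrite lt_neqAle tr_skew_sq_le0 ?rotT // andbT; apply/eqP => /(tr_skew_sq_eq0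
  rotT).
move/matrixP/(_ (Ordinal (ltnW hp)) (Ordinal hp)) => /eqP.
by rewrite !mxE !eqxx /= subr0 oner_eq0.
Qed.

Definition rot_su : 'M[R]_(p + p) := block_mx rot 0 0 rot.
Definition rot_anti : 'M[R]_(p + p) := block_mx rot 0 0 (- rot).

Lemma rot_suT : rot_su^T = - rot_su.
Proof. by rewrite /rot_su tr_block_mx opp_block_mx !trmx0 oppr0 rotT. Qed.
Lemma rot_antiT : rot_anti^T = - rot_anti.
Proof.
by rewrite /rot_anti tr_block_mx opp_block_mx !trmx0 oppr0 trmxN rotT.
Qed.

Lemma rot_su_comm : J *m rot_su = rot_su *m J.
Proof.
rewrite /stdJ /rot_su !mulmx_block.
by rewrite !(mul0mx, mulmx0, mulmxN, mulNmx, add0r, addr0, mulmx1, mul1mx).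
Qed.
Lemma rot_su_trJ : \tr (rot_su *m J) = 0.
Proof.
rewrite /stdJ /rot_su !mulmx_block mxtrace_block.
by rewrite !(mul0mx, mulmx0, addr0, mxtrace0).
Qed.
Lemma rot_anti_anti : J *m rot_anti = - (rot_anti *m J).
Proof.
rewrite /stdJ /rot_anti !mulmx_block opp_block_mx.
by rewrite !(mul0mx, mulmx0, mulmxN, mulNmx, add0r, addr0, mulmx1, mul1mx,
  opprK, oppr0).
Qed.
Lemma rot_su_sq : \tr (rot_su *m rot_su) < 0.
Proof.
rewrite /rot_su mulmx_block mxtrace_block !(mul0mx, mulmx0, add0r, addr0).
by have := tr_rot; lra.
Qed.
Lemma rot_anti_sq : \tr (rot_anti *m rot_anti) < 0.
Proof.
rewrite /rot_anti mulmx_block mxtrace_block !(mul0mx, mulmx0, add0r, addr0)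
  mulNmx mulmxN opprK.
by have := tr_rot; lra.
Qed.

Let K := (p + p + q)%:R - 2 : R.
Lemma K_gt0 : 0 < K. Proof. exact: dim_gt2 kq_gt2. Qed.

Lemma metric_rot_su u0 u1 u3 :
  met u0 u1 u3 (emb rot_su 0) (emb rot_su 0) = - u1 * (K * \tr (rot_su *m
    rot_su)).
Proof.
rewrite metric_emb soscale_su ?rot_su_comm ?rot_su_trJ // trmx0 mul0mx mxtrace0.
by rewrite -scalemxAl mxtraceZ /K; ring.
Qed.
Lemma metric_rot_anti u0 u1 u3 :
  met u0 u1 u3 (emb rot_anti 0) (emb rot_anti 0) = - u3 * (K * \tr (rot_anti *m
    rot_anti)).
Proof.
rewrite metric_emb soscale_anti ?rot_anti_anti // trmx0 mul0mx mxtrace0.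
by rewrite -scalemxAl mxtraceZ /K; ring.
Qed.

Lemma rot_su_nz : K * \tr (rot_su *m rot_su) != 0.
Proof. by rewrite mulf_neq0 ?(gt_eqF K_gt0) ?(lt_eqF rot_su_sq). Qed.
Lemma rot_anti_nz : K * \tr (rot_anti *m rot_anti) != 0.
Proof. by rewrite mulf_neq0 ?(gt_eqF K_gt0) ?(lt_eqF rot_anti_sq). Qed.

(** Both metrics agree on m2, so the factor is 1. *)
Lemma proportional_metrics u0 u1 u3 v0 v1 v3 :
  proportional (met u0 u1 u3) (met v0 v1 v3) -> u1 = v1 /\ u3 = v3.
Proof.
case=> c c0 h; have K0 := K_gt0.
have c1 : c = 1.
  pose b : 'M[R]_(p + p, q) := delta_mx (Ordinal (ltn_addr p (ltnW hp)))
    (Ordinal hq).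
  have tb : \tr (b^T *m b) != 0.
    apply/eqP => /mxtrace_tr_mul_eq0 /matrixP /(_ (Ordinal (ltn_addr p (ltnW
      hp))) (Ordinal hq)) /eqP.
    by rewrite !mxE !eqxx oner_eq0.
  have e0 : emb 0 b \in mm R (p + p) q by rewrite emb_mm // linear0 oppr0.
  have := h _ _ e0 e0; rewrite !metric_emb !mulmx0 !mxtrace0 !subr0 => e.
  have nz : K * (2 * \tr (b^T *m b)) != 0 by rewrite !mulf_neq0 ?pnatr_eq0 //
    gt_eqF.
  by apply: (mulIf nz); rewrite mul1r -e.
have e1 : emb rot_su 0 \in mm R (p + p) q by rewrite emb_mm // rot_suT.
have e3 : emb rot_anti 0 \in mm R (p + p) q by rewrite emb_mm // rot_antiT.
have := h _ _ e1 e1; have := h _ _ e3 e3; rewrite c1 !mul1r !metric_rot_su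
  !metric_rot_anti.
by move=> /(mulIf rot_anti_nz)/oppr_inj -> /(mulIf rot_su_nz)/oppr_inj ->.
Qed.

Lemma ulblockE a : ulblock q a = emb a 0 :> 'M[R]_(p + p + q).
Proof. by rewrite /emb linear0 oppr0. Qed.

Lemma killing_emb a b a' b' :
  killing (emb a b) (emb a' b' : 'M[R]_(p + p + q)) = K * (\tr (a *m a') - 2 *
    \tr (b^T *m b')).
Proof.
rewrite /emb killing_block mul0mx mxtrace0 addr0 mulmxN mulNmx !mxtraceN.
by rewrite (mxtrace_mulC a') (mxtrace_mulC b') (mxtrace_trC b'); congr (_ * _);
  ring.
Qed.

(** A multiple of the Killing form on so(2p) has the same scale on su(p) and
    on m3. *)
Lemma jensen_scales u0 u1 u3 : jensen (met u0 u1 u3) -> u1 = u3.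
Proof.
case=> _ _ [x [y [_ _ h]]].
have hx a : a^T = - a -> met u0 u1 u3 (emb a 0) (emb a 0) = - x * (K * \tr (a
  *m a)).
  move=> ha; have ua : emb a 0 \in so_ul R (p + p) q.
    by apply/so_ulP; exists a; rewrite ?ulblockE.
  have := h _ _ _ _ ua ua (mem0v _) (mem0v _); rewrite !addr0 => ->.
  by rewrite killing_emb mulmx0 mxtrace0 /killing mul0mx mxtrace0; ring.
have := hx _ rot_suT; have := hx _ rot_antiT; rewrite metric_rot_su
  metric_rot_anti.
have K0 := K_gt0.
by move=> /(mulIf rot_anti_nz)/oppr_inj -> /(mulIf rot_su_nz)/oppr_inj ->.
Qed.

Lemma jensen_metric x mu :
  0 < x -> einstein_system p q x x x mu -> jensen (met x x x).
Proof.
move=> x0 hs; have hkq := kq_gt2.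
split.
- by apply: metric_einstein hs => //; [lia|exact: stdJT|exact: stdJJ].
- apply: metric_invariant => // A [hA _]; split=> // a.
  by rewrite !soscale_const // -scalemxAr -scalemxAl.
exists x, 1; split=> // A A' Z Z' /so_ulP[a _ ->] /so_ulP[a' _ ->].
move=> /(mm2P hkq)[b ->] /(mm2P hkq)[b' ->].
rewrite !ulblockE -[emb a 0]scale1r -[emb a' 0]scale1r -!emb_linear !scaler0
  !add0r.
rewrite !addr0 !scale1r metric_emb !killing_emb soscale_const // -scalemxAl
  mxtraceZ.
by rewrite ?(mulmx0, mul0mx, mxtrace0, trmx0) /K; ring.
Qed.

Lemma metric_unitary u0 u1 u3 :
  Ad_invariant (@unitary_group R p) (met u0 u1 u3).
Proof.
have hkq := kq_gt2.
apply: metric_invariant => // A [M hM ->].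
have hA := unitary_realify hM; split=> // a.
by apply: soscale_equivariant => //; [exact: stdJT|exact: realify_J].
Qed.
End Separation.

Theorem theorem4p1 (R : realType) (n p : nat)
    (hp : (2 <= p)%N) (hn : p%:R <= 2 / 5 * n%:R - 1 :> R) :
  exists g : 'I_4 -> bform R (p + p) (n - 2 * p),
    [/\ forall i, einstein (g i) /\ Ad_invariant (@unitary_group R p) (g i),
        forall i j, i != j -> ~ proportional (g i) (g j)
      & forall i, jensen (g i) <-> (i < 2)%N].
Proof.
have hnat : (5 * p + 5 <= 2 * n)%N.
  by rewrite -(ler_nat R) natrD !natrM; lra.
set q := (n - 2 * p)%N.
have hpq : (p + 5 <= 2 * q)%N by rewrite /q; lia.
have hq : (0 < q)%N by lia.
have hkq := kq_gt2 hp hq.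
have [x [y [x0 y0 xy xyE]]] := jensen_roots R hp hpq.
have [z [t [z0 t0 zt ztE]]] := other_solutions R hp hpq.
pose r1 z := ratio1 p (q%:R * z ^+ 2) * z : R.
pose r0 z := ratio0 p (q%:R * z ^+ 2) * z : R.
(* The scales (u0, u1, u3) of two Jensen metrics and of the two others. *)
pose u := nth (0, 0, 0) [:: (x, x, x); (y, y, y); (r0 z, r1 z, z); (r0 t, r1 t,
  t)].
have uJ w : w = x \/ w = y -> 0 < w -> exists mu, einstein_system p q w w w mu.
  by move=> hw w0; eexists; apply: jensen_solution => //; apply: xyE.
have uO w : w = z \/ w = t -> 0 < w -> [/\ 0 < r0 w, 0 < r1 w, r1 w != w &
     exists mu, einstein_system p q (r0 w) (r1 w) w mu].
  move=> hw w0; have [e ne] := ztE _ hw; have s0 := qsq_gt0 hp hpq w0.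
  split.
  - by rewrite mulr_gt0 // ratio0_gt0.
  - by rewrite mulr_gt0 // ratio1_gt0.
  - apply: contra (ratio1_neq1 hp s0 ne) => /eqP h; apply/eqP.
    by apply: (mulIf (lt0r_neq0 w0)); rewrite mul1r.
  by eexists; apply: residual_solution.
exists (fun i : 'I_4 => stiefel_metric (stdJ R p) (u i).1.1 (u i).1.2 (u i).2).
have [z0' z1 z3 zmu] := uO z (or_introl erefl) z0.
have [t0' t1 t3 tmu] := uO t (or_intror erefl) t0.
split.
- move=> i; split; last exact: metric_unitary.
  have [] : [/\ 0 < (u i).1.1, 0 < (u i).1.2, 0 < (u i).2 &
     exists mu, einstein_system p q (u i).1.1 (u i).1.2 (u i).2 mu].
    case: i => -[|[|[|[|//]]]] hi; rewrite /u /=; split=> //.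
      by apply: uJ => //; left.
    by apply: uJ => //; right.
  move=> h0 h1 h3 [mu hmu]; apply: metric_einstein hmu => //.
  + exact: ltnW hp.
  + exact: stdJT.
  + exact: stdJJ.
- move=> i j nij /(proportional_metrics hp hq) [].
  move: nij; case: i => -[|[|[|[|//]]]] hi; case: j => -[|[|[|[|//]]]] hj nij;
    rewrite /u /= => e1 e3; try (by case/eqP: nij; apply: val_inj).
  + by case/eqP: xy.
  + by case/eqP: z3; exact: etrans (esym e1) e3.
  + by case/eqP: t3; exact: etrans (esym e1) e3.
  + by case/eqP: xy.
  + by case/eqP: z3; exact: etrans (esym e1) e3.
  + by case/eqP: t3; exact: etrans (esym e1) e3.
  + by case/eqP: z3; exact: etrans e1 (esym e3).
  + by case/eqP: z3; exact: etrans e1 (esym e3).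
  + by case/eqP: zt.
  + by case/eqP: t3; exact: etrans e1 (esym e3).
  + by case/eqP: t3; exact: etrans e1 (esym e3).
  + by case/eqP: zt.
move=> i; split.
  move/(jensen_scales hp hq); case: i => -[|[|[|[|//]]]] hi //; rewrite /u /=
    => e.
    by case/eqP: z3.
  by case/eqP: t3.
case: i => -[|[|//]] hi _; rewrite /u /=.
  by have [mu] := uJ x (or_introl erefl) x0; apply: jensen_metric.
by have [mu] := uJ y (or_intror erefl) y0; apply: jensen_metric.
Qed.
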